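(* There is an absolute constant $C>0$ such that the following holds. Let $d\ge 2$ and $m\ge 1$ be integers and let $Y\subseteq\mathbb{R}^d$ be a set of points each of which has at most $m$ nonzero coordinates, where $\mathbb{R}^d$ is endowed with the $\ell_1$ norm. Then there is a linear map $\Phi:\mathbb{R}^d\to\mathbb{R}^n$ with $n\le C m\log^2 d$ and positive numbers $A,B$ with $B/A\le C\log^2(d)\log^3(m)$ (when $m\ge 2$) such that $$A\|x-y\|_1\le \|\Phi x-\Phi y\|_1\le B\|x-y\|_1\quad\text{for all }x,y\in Y,$$ i.e. $Y$ embeds linearly into $\ell_1^n$ with distortion $O(\log^2(d)\log^3(m))$. Moreover, there is an algorithm that, given $\Phi x$ for a point $x\in Y$, reconstructs $x$ in time $O(m\log^2(m)\log^2(d))$.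
   Context: A map $\Phi$ between metric spaces $(X,d_X)$, $(Y',d_{Y'})$ embeds with distortion $D$ if there are $A,B>0$ with $B/A\le D$ and $A\,d_X(x,y)\le d_{Y'}(\Phi x,\Phi y)\le B\,d_X(x,y)$ for all $x,y$. $\ell_1^n$ denotes $\mathbb{R}^n$ with the $\ell_1$ norm. *)

(* Defs.v *)
From mathcomp Require Import all_boot all_order all_algebra.
From mathcomp Require Import all_classical all_reals all_analysis.

Set Implicit Arguments.
Unset Strict Implicit.
Unset Printing Implicit Defensive.

Import Order.TTheory GRing.Theory Num.Theory.
Local Open Scope ring_scope.

(* The canonical norm on matrices in MathComp-Analysis is the sup norm. *)
Definition l1norm (R : realType) (n : nat) (x : 'cV[R]_n) : R :=
  \sum_(i < n) `|x i 0|.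

Definition nnz (R : realType) (n : nat) (x : 'cV[R]_n) : nat :=
  #|[set i : 'I_n | x i 0 != 0]|.

(** * Unit-cost real RAM

   Time is counted on a real random-access machine with one memory of natural
   numbers and one of exact real numbers, both indirectly addressed.  Programs
   are structured (sequence, conditional, loop), and every occurrence of an
   operation, constant, memory access, comparison, assignment or test costs one
   each time it is executed.  As usual for the unit-cost RAM, naturals
   are only added, subtracted and compared: unit-cost multiplication would
   produce numbers of exponential length.  There is no floor function, and no
   conversion between reals and naturals: the two interact only through
   comparisons of reals.

   A program also has read-only random access to a matrix stored by columns:
   each column is the list of (row, value) pairs of its nonzero entries. *)

Inductive nexpr : Type :=
| NConst of nat
| NMem of nexpr
| NAdd of nexpr & nexpr
| NSub of nexpr & nexpr
| ColSize of nexpr          (* number of nonzero entries of column j *)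
| ColRow of nexpr & nexpr.  (* row of the k-th nonzero entry of column j *)

Inductive rexpr : Type :=
| RConst of nat
| RMem of nexpr
| RAdd of rexpr & rexpr
| RSub of rexpr & rexpr
| RMul of rexpr & rexpr
| RDiv of rexpr & rexpr
| ColVal of nexpr & nexpr.  (* value of the k-th nonzero entry of column j *)

Inductive bexpr : Type :=
| NLt of nexpr & nexpr
| RLt of rexpr & rexpr
| BNot of bexpr
| BAnd of bexpr & bexpr.

Inductive cmd : Type :=
| Skip
| NStore of nexpr & nexpr   (* address, value *)
| RStore of nexpr & rexpr   (* address, value *)
| Seq of cmd & cmd
| If of bexpr & cmd & cmd
| While of bexpr & cmd.

Fixpoint ncost (e : nexpr) : nat :=
  match e with
  | NConst _ => 1
  | NMem a | ColSize a => (ncost a).+1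
  | NAdd a b | NSub a b | ColRow a b => (ncost a + ncost b).+1
  end.

Fixpoint rcost (e : rexpr) : nat :=
  match e with
  | RConst _ => 1
  | RMem a => (ncost a).+1
  | RAdd a b | RSub a b | RMul a b | RDiv a b => (rcost a + rcost b).+1
  | ColVal a b => (ncost a + ncost b).+1
  end.

Fixpoint bcost (e : bexpr) : nat :=
  match e with
  | NLt a b => (ncost a + ncost b).+1
  | RLt a b => (rcost a + rcost b).+1
  | BNot a => (bcost a).+1
  | BAnd a b => (bcost a + bcost b).+1
  end.

Record state (R : realType) : Type :=
  State { nmem : nat -> nat; rmem : nat -> R }.

Definition columns (R : realType) : Type := nat -> seq (nat * R).

Definition csc (R : realType) (n d : nat) (Phi : 'M[R]_(n, d)) : columns R :=
  fun j => if insub j is Some j' then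
             [seq (val i, Phi i j') | i <- enum 'I_n & Phi i j' != 0]
           else [::].

Fixpoint neval (R : realType) (M : columns R) (s : state R) (e : nexpr) : nat :=
  match e with
  | NConst c => c
  | NMem a => nmem s (neval M s a)
  | NAdd a b => (neval M s a + neval M s b)%N
  | NSub a b => (neval M s a - neval M s b)%N
  | ColSize j => size (M (neval M s j))
  | ColRow j k => (nth (0%N, 0) (M (neval M s j)) (neval M s k)).1
  end.

Fixpoint reval (R : realType) (M : columns R) (s : state R) (e : rexpr) : R :=
  match e with
  | RConst c => c%:R
  | RMem a => rmem s (neval M s a)
  | RAdd a b => reval M s a + reval M s b
  | RSub a b => reval M s a - reval M s b
  | RMul a b => reval M s a * reval M s b
  | RDiv a b => reval M s a / reval M s b
  | ColVal j k => (nth (0%N, 0) (M (neval M s j)) (neval M s k)).2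
  end.

Fixpoint beval (R : realType) (M : columns R) (s : state R) (e : bexpr) : bool :=
  match e with
  | NLt a b => (neval M s a < neval M s b)%N
  | RLt a b => reval M s a < reval M s b
  | BNot a => ~~ beval M s a
  | BAnd a b => beval M s a && beval M s b
  end.

Definition nupdate (R : realType) (s : state R) (a v : nat) : state R :=
  State (fun k => if k == a then v else nmem s k) (rmem s).

Definition rupdate (R : realType) (s : state R) (a : nat) (v : R) : state R :=
  State (nmem s) (fun k => if k == a then v else rmem s k).

(* [exec M c s t s']: started in state [s] with the matrix [M], the program [c]
   halts after [t] units of time in state [s']. *)
Inductive exec (R : realType) (M : columns R) :
    cmd -> state R -> nat -> state R -> Prop :=
| exec_skip s : exec M Skip s 1 s
| exec_nstore s a e :
    exec M (NStore a e) s (ncost a + ncost e).+1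
      (nupdate s (neval M s a) (neval M s e))
| exec_rstore s a e :
    exec M (RStore a e) s (ncost a + rcost e).+1
      (rupdate s (neval M s a) (reval M s e))
| exec_seq c1 c2 s s1 s2 t1 t2 :
    exec M c1 s t1 s1 -> exec M c2 s1 t2 s2 ->
    exec M (Seq c1 c2) s (t1 + t2)%N s2
| exec_if b c1 c2 s s1 t :
    exec M (if beval M s b then c1 else c2) s t s1 ->
    exec M (If b c1 c2) s (bcost b + t).+1 s1
| exec_while_false b c s :
    ~~ beval M s b -> exec M (While b c) s (bcost b).+1 s
| exec_while_true b c s s1 s2 t1 t2 :
    beval M s b -> exec M c s t1 s1 -> exec M (While b c) s1 t2 s2 ->
    exec M (While b c) s (bcost b + t1 + t2).+1 s2.

(* Input: d, m, n in natural cells 0, 1, 2 and the n coordinates of the sketch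
   in real cells 0, ..., n - 1; all other cells are 0. *)
Definition input (R : realType) (d m n : nat) (v : 'cV[R]_n) : state R :=
  State (nth 0%N [:: d; m; n])
        (fun k => if insub k is Some i then v i 0 else 0).

(* Reading off d coordinates would already exceed a running time that is
   polylogarithmic in d, so a vector is output in sparse form: natural cell 0
   holds the number k of listed coordinates, natural cells 1, ..., k their
   indices and real cells 0, ..., k - 1 their values. *)
Definition output (R : realType) (s : state R) : seq (nat * R) :=
  [seq (nmem s i.+1, rmem s i) | i <- iota 0 (nmem s 0)].

Definition sparse_repr (R : realType) (d : nat)
    (l : seq (nat * R)) (x : 'cV[R]_d) : Prop :=
  [/\ uniq (unzip1 l),
      all (fun j => (j < d)%N) (unzip1 l)
    & forall i : 'I_d, x i 0 = \sum_(p <- l | p.1 == i :> nat) p.2].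

(* Main.v *)
Require Import Defs.
From mathcomp Require Import all_boot all_order all_algebra zify lra ring.
From mathcomp Require Import all_classical all_reals all_analysis.

Set Implicit Arguments.
Unset Strict Implicit.
Unset Printing Implicit Defensive.

Import Order.TTheory GRing.Theory Num.Theory.

(** The columns of Phi come from a random bipartite graph: every coordinate is
    hashed L = O(log d) times into O(m) buckets, and a union bound over sets S
    of at most 3m coordinates and over the possible sets of collisions shows
    that some choice is an expander, |N(S)| >= 7/8 L |S|.  A bucket carries two
    rows, the sum of its coordinates and their sum weighted by (j + 1) / d.  The
    columns have l1 norm at most 2L, and on 2m-sparse vectors the plain sums
    alone have l1 norm at least 3/4 L times that of the vector, so the distortion
    is a constant.

    A bucket that contains a single nonzero coordinate reveals its value and, by
    binary search on the ratio of the two rows, its index.  The decoder keeps a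
    worklist of buckets, and subtracts the proposed multiple of a column when it
    agrees with the sketch on 3/4 of the rows of that column.  Each subtraction
    lowers the number of nonzero rows by at least L, so there are at most 2m of
    them and the residual stays 3m-sparse; expansion gives every nonzero
    3m-sparse residual a coordinate that is alone in 3/4 of its buckets, so the
    decoder only stops at residual zero. *)

(** * Existence of expanders *)

Lemma leq_card_bigcup (I T : finType) (P : pred I) (F : I -> {set T}) :
  #|\bigcup_(i | P i) F i| <= \sum_(i | P i) #|F i|.
Proof.
apply: (big_rec2 (fun (A : {set T}) k => #|A| <= k)) => [|i k A _ Ak].
  by rewrite cards0.
by apply: leq_trans (leq_card_setU _ _) _; rewrite leq_add2l.
Qed.

Section Expander.
Variables (d L W : nat).
Implicit Types (g : {ffun 'I_d * 'I_L -> 'I_W}) (S : {set 'I_d}).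

Definition nbhd g S : {set 'I_L * 'I_W} :=
  [set (p.2, g p) | p in finset.setX S [set: 'I_L]].

Definition coll g S : {set 'I_d * 'I_L} :=
  [set p in finset.setX S [set: 'I_L] |
    [exists j in S, (j < p.1) && (g (j, p.2) == g p)]].

(** Balls outside [coll g S] are the first of [S] in their bucket, so they inject into the
    neighbourhood. *)
Lemma card_nbhd_coll g S : #|S| * L <= #|nbhd g S| + #|coll g S|.
Proof.
have sub : coll g S \subset finset.setX S [set: 'I_L].
  by apply/fintype.subsetP => p; rewrite inE => /andP[].
have <- : #|finset.setX S [set: 'I_L]| = #|S| * L.
  by rewrite cardsX cardsT card_ord.
rewrite -(cardsID (coll g S) (finset.setX S _)) (finset.setIidPr sub) addnC leq_add2r.
have inj : {in finset.setX S [set: 'I_L] :\: coll g S &,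
    injective (fun p => (p.2, g p))}.
  move=> [j l] [j' l']; rewrite !inE /= !andbT.
  move=> /andP[nc jS] /andP[nc' j'S] [ell].
  rewrite -{l'}ell in nc' * => eg.
  case: (ltngtP j j') => [jj'|jj'|/val_inj -> //].
  - by move: nc'; rewrite j'S /= => /existsP[]; exists j; rewrite jS jj' eg eqxx.
  - by move: nc; rewrite jS /= => /existsP[]; exists j'; rewrite j'S jj' eg eqxx.
rewrite -(card_in_imset inj); apply/subset_leq_card/imsetS.
exact: finset.subsetDl.
Qed.

(* A hash function is determined by its values off [Q] together with, for each
   ball of [Q], an earlier element of [S] with which it collides. *)
Lemma card_coll_sup S (Q : {set 'I_d * 'I_L}) :
  #|[set g | Q \subset coll g S]| <= #|S| ^ #|Q| * W ^ (d * L - #|Q|).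
Proof.
case: (finset.set_0Vmem Q) => [->|[p0 p0Q]].
  rewrite cards0 expn0 mul1n subn0 (leq_trans (max_card _)) //.
  by rewrite card_ffun card_prod !card_ord.
pose wit g (p : 'I_d * 'I_L) := odflt p.1
  [pick j in S | (j < p.1) && (g (j, p.2) == g p)].
pose enc g := [ffun p => if p \in Q then (inr (wit g p) : 'I_W + 'I_d)%type else inl (g p)].
pose F (p : 'I_d * 'I_L) : pred ('I_W + 'I_d)%type := fun x =>
  match x with inl w => p \notin Q | inr j => (p \in Q) && (j \in S) end.
have witP g p : Q \subset coll g S -> p \in Q ->
    [/\ wit g p \in S, wit g p < p.1 & g (wit g p, p.2) = g p].
  move=> /fintype.subsetP QC /QC; rewrite inE => /andP[_ /exists_inP[j jS jP]].
  rewrite /wit; case: pickP => [k /and3P[? ? /eqP ?]|/(_ j)] //=.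
  by rewrite jS jP.
have encI : {in [set g | Q \subset coll g S] &, injective enc}.
  move=> g g'; rewrite !inE => gQ g'Q /ffunP eqe.
  (* Induction on the coordinate: a ball of [Q] takes the value of its witness, an earlier
     coordinate in the same layer, where [g] and [g'] already agree. *)
  have H k (p : 'I_d * 'I_L) : p.1 < k -> g p = g' p.
    elim: k p => // k IH p pk.
    have := eqe p; rewrite !ffunE; case: ifP => [pQ|_ [] //] [ew].
    have [_ l1 <-] := witP _ _ gQ pQ; have [_ l2 <-] := witP _ _ g'Q pQ.
    by rewrite -ew IH //= (leq_trans l1).
  by apply/ffunP => p; apply: (H p.1.+1).
rewrite -(card_in_imset encI).
have sub : enc @: [set g | Q \subset coll g S] \subset family F.
  apply/fintype.subsetP => _ /imsetP[g gQ ->]; apply/familyP => p.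
  rewrite inE in gQ; rewrite ffunE /F unfold_in; case: ifPn => //= pQ.
  by have [] := witP _ _ gQ pQ.
apply: (leq_trans (subset_leq_card sub)); rewrite card_family.
have cF p : #|F p| = if p \in Q then #|S| else W.
  case: ifPn => pQ.
    rewrite -(@card_imset _ ('I_W + 'I_d)%type inr S inr_inj); apply: eq_card => -[w|j].
      by rewrite unfold_in /= pQ; apply/esym/negbTE/imsetP => -[].
    by rewrite unfold_in /= pQ /= mem_imset //; exact: inr_inj.
  rewrite -[RHS](card_ord W) -cardsT -(@card_imset _ ('I_W + 'I_d)%type inl [set: 'I_W] inl_inj).
  apply: eq_card => -[w|j].
    by rewrite unfold_in /= pQ mem_imset ?inE //; exact: inl_inj.
  by rewrite unfold_in /= (negPf pQ); apply/esym/negbTE/imsetP => -[].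
rewrite foldrE big_map big_enum /= (bigID (mem Q)) /=.
rewrite (eq_bigr (fun=> #|S|)) => [|p pQ]; last by rewrite cF pQ.
rewrite [X in _ * X](eq_bigr (fun=> W)) => [|p pQ]; last by rewrite cF (negPf pQ).
rewrite !prod_nat_const leq_mul2l; apply/orP; right.
have -> : #|[predC Q]| = d * L - #|Q|; last by [].
by have := cardC (mem Q); rewrite card_prod !card_ord => <-; rewrite addKn.
Qed.

(* As [16 |Q| >= 2 L |S|], the factor [2 ^ (16 |Q|)] in [W] pays for the union
   over the sets [Q] and leaves [2 ^ (L |S|)] for the union over [S]. *)
Lemma card_bad_set (s : nat) S : #|S| <= s -> s * 2 ^ 16 <= W ->
  #|[set g | 8 * #|nbhd g S| < 7 * (#|S| * L)]| * 2 ^ (#|S| * L) <= W ^ (d * L).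
Proof.
move=> Ss sW; set Bad := [set g | _]; set N := #|S| * L.
(* Failure of expansion forces more than [N / 8] collisions, so [coll g S] is itself one of these
   [Q]. *)
pose Qs := [set Q : {set 'I_d * 'I_L} | Q \subset finset.setX S [set: 'I_L] & N <= 8 * #|Q|].
have cN : #|finset.setX S [set: 'I_L]| = N by rewrite cardsX cardsT card_ord.
have cQs : #|Qs| <= 2 ^ N.
  rewrite -cN -card_powerset; apply/subset_leq_card/fintype.subsetP => Q.
  by rewrite !inE => /andP[].
have BadQ : Bad \subset \bigcup_(Q in Qs) [set g | Q \subset coll g S].
  apply/fintype.subsetP => g; rewrite inE => gS; apply/finset.bigcupP.
  exists (coll g S); rewrite inE // -/N in gS *; apply/andP; split.
    by apply/fintype.subsetP => p; rewrite inE => /andP[].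
  by have := card_nbhd_coll g S; rewrite -/N; lia.
have cQ Q : Q \in Qs -> #|[set g | Q \subset coll g S]| * 2 ^ (2 * N) <= W ^ (d * L).
  rewrite inE => /andP[_ NQ].
  have QM : #|Q| <= d * L by rewrite (leq_trans (max_card _)) // card_prod !card_ord.
  apply: (leq_trans (leq_mul (card_coll_sup _ _) (leqnn _))).
  rewrite mulnAC -[in X in _ <= X](subnKC QM) expnD leq_mul2r; apply/orP; right.
  apply: (@leq_trans ((#|S| * 2 ^ 16) ^ #|Q|)).
    by rewrite expnMn -expnM leq_mul2l leq_exp2l //; apply/orP; right; lia.
  case: (#|Q|) => [|q]; first by rewrite !expn0.
  by rewrite leq_exp2r // (leq_trans _ sW) // leq_mul2r Ss orbT.
rewrite -(@leq_pmul2r (2 ^ N)) ?expn_gt0 // -mulnA -expnD addnn -mul2n.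
rewrite mulnC [X in _ <= X]mulnC.
apply: (@leq_trans (2 ^ (2 * N) * \sum_(Q in Qs) #|[set g | Q \subset coll g S]|)).
  rewrite leq_mul2l; apply/orP; right.
  by rewrite (leq_trans (subset_leq_card BadQ)) // leq_card_bigcup.
rewrite big_distrr /= (leq_trans _ (leq_mul cQs (leqnn _))) // -sum_nat_const.
by apply: leq_sum => Q QQ; rewrite mulnC cQ.
Qed.

End Expander.

(** * The union bound over sets of coordinates *)

Local Open Scope ring_scope.

(** Expanding a product with one factor [t + 1] per element of [T] gives one term per subset. *)
Lemma sum_expr_card (F : comNzRingType) (T : finType) (t : F) :
  \sum_(S : {set T}) t ^+ #|S| = (1 + t) ^+ #|T|.
Proof.
transitivity (\prod_(i : T) (t + 1)); last by rewrite prodr_const addrC.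
rewrite bigA_distr; apply: eq_bigr => S _.
by rewrite -big_mkcond /= prodr_const.
Qed.

(** A linear substitute for [(1 + t) ^ k <= exp (k t)], by induction on [k]. *)
Lemma exprD1_le (F : realFieldType) (t : F) (k : nat) :
  0 <= t -> 2 * k%:R * t <= 1 -> (1 + t) ^+ k <= 1 + 2 * k%:R * t.
Proof.
move=> t0; elim: k => [|k IH] kt; first by rewrite expr0; lra.
rewrite exprS; have k0 : 0 <= k%:R :> F by [].
rewrite -natr1 in kt *.
have kt' : 2 * k%:R * t <= 1 by nra.
by have := IH kt'; nra.
Qed.

(** If every [g] had a bad nonempty set, the [W ^ (d * L)] functions would be covered by bad events.
    By [card_bad_set] their sizes add up to at most [(1 + t) ^ d - 1 < 1] times that number, with
    [t = 1 / 2 ^ L]. *)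
Theorem expander_exists (d L W s : nat) :
  (0 < W)%N -> (s * 2 ^ 16 <= W)%N -> (2 * d < 2 ^ L)%N ->
  exists g : {ffun 'I_d * 'I_L -> 'I_W}, forall S : {set 'I_d},
    (#|S| <= s)%N -> (7 * (#|S| * L) <= 8 * #|nbhd g S|)%N.
Proof.
move=> W0 sW dL.
pose bad (g : {ffun 'I_d * 'I_L -> 'I_W}) (S : {set 'I_d}) :=
  [&& S != finset.set0, #|S| <= s & 8 * #|nbhd g S| < 7 * (#|S| * L)]%N.
case: (boolP [exists g, ~~ [exists S, bad g S]]) => [/existsP[g /existsPn gP]|].
  exists g => S Ss; have := gP S; rewrite /bad Ss /=.
  by case: eqP => [->|_]; rewrite ?cards0 // -leqNgt.
move=> /existsPn allbad; exfalso.
pose P (S : {set 'I_d}) := (S != finset.set0) && (#|S| <= s)%N.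
have cover : [set: {ffun 'I_d * 'I_L -> 'I_W}] \subset
    \bigcup_(S | P S) [set g | (8 * #|nbhd g S| < 7 * (#|S| * L))%N].
  apply/fintype.subsetP => g _; have := allbad g; rewrite negbK => /existsP[S].
  by move=> /and3P[S0 Ss gS]; apply/finset.bigcupP; exists S; rewrite ?inE // /P S0.
have := leq_trans (subset_leq_card cover) (leq_card_bigcup _ _).
rewrite cardsT card_ffun card_prod !card_ord; apply/negP; rewrite -ltnNge.
rewrite -(ltr_nat rat) natr_sum.
set t : rat := (2 ^+ L)^-1.
have t0 : 0 < t by rewrite invr_gt0 exprn_gt0.
set M : rat := (W ^ (d * L))%:R.
have M0 : 0 < M by rewrite ltr0n expn_gt0 W0.
apply: (@le_lt_trans _ _ (\sum_(S : {set 'I_d} | P S) M * t ^+ #|S|)).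
  apply: ler_sum => S /andP[_ Ss].
  rewrite exprVn -exprM ler_pdivlMr ?exprn_gt0 // -natrX -natrM ler_nat.
  by rewrite [(L * _)%N]mulnC (card_bad_set _ Ss sW).
rewrite -mulr_sumr -[ltRHS]mulr1 ltr_pM2l //.
apply: (@le_lt_trans _ _ ((1 + t) ^+ d - 1)).
  have := sum_expr_card ('I_d) t; rewrite card_ord => <-.
  (* The empty set is the term 1 of the expansion; [P] excludes it. *)
  rewrite [X in _ <= X - 1](bigD1 finset.set0) //= cards0 expr0 [leRHS]addrC addKr.
  rewrite big_mkcond [leRHS]big_mkcond /=; apply: ler_sum => S _; rewrite /P.
  by case: eqP => //= _; case: ifP => // _; rewrite exprn_ge0 // ltW.
have dt : 2 * d%:R * t < 1.
  rewrite ltr_pdivrMr ?exprn_gt0 // mul1r -natrM -natrX ltr_nat; exact: dL.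
by have := exprD1_le (ltW t0) (ltW dt); lra.
Qed.

(** * Unique neighbours and the l1 norm *)

Section ExpanderGraph.
Variables (B J : finType) (adj : B -> J -> bool) (L s : nat).

(** A left-regular bipartite expander that loses at most an eighth of the edges, with the
    coordinates [J] on the left and the buckets [B] on the right. *)
Definition expander : Prop :=
  (forall j, #|[set b | adj b j]| = L) /\
  (forall S : {set J}, (#|S| <= s)%N ->
     (7 * (#|S| * L) <= 8 * #|[set b | [exists j in S, adj b j]]|)%N).

Definition unique_nbrs (S : {set J}) j : {set B} :=
  [set b | adj b j & [forall j' in S, adj b j' ==> (j' == j)]].

Hypothesis expP : expander.

(** Each bucket meeting [S] is a unique neighbour or receives two edges, so twice their number is at
    most the count of unique neighbours plus [L |S|]. Expansion 7/8 then leaves [(7/4 - 1) L] unique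
    neighbours per element of [S] on average. *)
Lemma expander_unique (S : {set J}) : S != finset.set0 -> (#|S| <= s)%N ->
  exists2 j, j \in S & (3 * L <= 4 * #|unique_nbrs S j|)%N.
Proof.
case: expP => deg expn S0 Ss.
case: (boolP [exists j in S, (3 * L <= 4 * #|unique_nbrs S j|)%N]).
  by move=> /exists_inP[j jS jL]; exists j.
move=> /exists_inPn none; exfalso.
pose dS b := \sum_(j in S) (adj b j : nat).
have sumd : (\sum_b dS b = #|S| * L)%N.
  rewrite /dS exchange_big /= -sum_nat_const; apply: eq_bigr => j _.
  by rewrite -(deg j) cardsE -sum1_card [RHS]big_mkcond /=; apply: eq_bigr => b _; rewrite unfold_in; case: (adj b j).
have key b : (2 * [exists j in S, adj b j] <=
    \sum_(j in S) (b \in unique_nbrs S j : nat) + dS b)%N.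
  case: (boolP [exists j in S, adj b j]) => [/exists_inP[j jS bj]|]; last by rewrite muln0.
  rewrite muln1 /dS (bigD1 j) //= [X in (_ <= _ + X)%N](bigD1 j) //= bj.
  case: (boolP [forall j' in S, adj b j' ==> (j' == j)]) => [u|].
    by rewrite inE bj u /=; lia.
  rewrite negb_forall_in => /exists_inP[j' j'S]; rewrite negb_imply => /andP[bj' nj].
  by rewrite [X in (_ <= _ + (_ + X))%N](bigD1 j') /= ?j'S ?bj' //; lia.
have {key} key : (2 * #|[set b | [exists j in S, adj b j]]| <=
    \sum_(j in S) #|unique_nbrs S j| + #|S| * L)%N.
  have -> : (\sum_(j in S) #|unique_nbrs S j| =
      \sum_b \sum_(j in S) (b \in unique_nbrs S j : nat))%N.
    rewrite exchange_big /=; apply: eq_bigr => j _.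
    by rewrite -sum1_card big_mkcond.
  rewrite -sumd -big_split /= cardsE -sum1_card big_distrr /= big_mkcond /=.
  by apply: leq_sum => b _; apply: leq_trans (key b); rewrite unfold_in; case: ifP.
have : (4 * \sum_(j in S) #|unique_nbrs S j| < 3 * (#|S| * L))%N.
  have -> : (3 * (#|S| * L) = \sum_(j in S) 3 * L)%N by rewrite sum_nat_const; lia.
  case/finset.set0Pn: S0 => j0 j0S.
  rewrite big_distrr /= (bigD1 j0) //= [X in (_ < X)%N](bigD1 j0) //=.
  rewrite -addSn leq_add //; first by rewrite ltnNge none.
  by apply: leq_sum => j /andP[jS _]; rewrite ltnW // ltnNge none.
by have := expn S Ss; lia.
Qed.

Variable R : realFieldType.
Implicit Types w : J -> R.

Let mx b w := \big[Order.max/0]_(j | adj b j) w j.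

Let mxP b w : mx b w = 0 \/ exists2 j, adj b j & mx b w = w j.
Proof.
rewrite /mx; apply: (big_ind (fun x => x = 0 \/ exists2 j, adj b j & x = w j)).
- by left.
- by move=> x y Hx Hy; rewrite maxEle; case: ifP.
- by move=> j bj; right; exists j.
Qed.

Let mx_ge0 b w : 0 <= mx b w.
Proof. exact: bigmax_ge_id. Qed.

(* Induction on the support: subtract the least nonzero value from all of it. *)
Lemma expander_max w : (forall j, 0 <= w j) -> (#|[set j | w j != 0%R]| <= s)%N ->
  7 * L%:R * \sum_j w j <= 8 * \sum_b \big[Order.max/0]_(j | adj b j) w j.
Proof.
rewrite -/(mx _ w); have [n] := ubnP #|[set j | w j != 0]|.
elim: n w => // n IH w wn w0 ws.
set S := [set j | w j != 0]; have [S0|[j0 j0S]] := finset.set_0Vmem S.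
  rewrite big1 ?mulr0 => [|j _].
    by rewrite mulr_ge0 // sumr_ge0 // => b _; exact: mx_ge0.
  by have := finset.in_set0 j; rewrite -S0 inE => /negbFE/eqP.
have wj0 : w j0 != 0 by rewrite inE in j0S.
pose j1 := [arg min_(j < j0 | w j != 0) w j]%O.
have [wj1 j1min] : w j1 != 0 /\ forall j, w j != 0 -> w j1 <= w j.
  by rewrite /j1; case: arg_minP.
set t := w j1 in wj1 j1min.
pose w' j := if w j != 0 then w j - t else 0.
have wE j : w j = w' j + (j \in S)%:R * t.
  by rewrite /w' inE; case: eqP => [->|_] /=; rewrite ?mul0r ?addr0 // mul1r subrK.
have w'0 j : 0 <= w' j.
  by rewrite /w'; case: ifPn => // wj; rewrite subr_ge0 j1min.
have subS : [set j | w' j != 0] \proper S.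
  apply/fintype.properP; split.
    by apply/fintype.subsetP => j; rewrite !inE /w'; case: (w j =P 0) => //=; rewrite eqxx.
  by exists j1; rewrite !inE /w' /= -/t ?wj1 //= subrr eqxx.
have IH' := IH w' (leq_trans (proper_card subS) wn) w'0
  (leq_trans (ltnW (proper_card subS)) ws).
have -> : \sum_j w j = \sum_j w' j + #|S|%:R * t.
  rewrite (eq_bigr _ (fun j _ => wE j)) big_split /= -mulr_suml; congr (_ + _ * _).
  by rewrite -sum1_card natr_sum [RHS]big_mkcond; apply: eq_bigr => j _; case: (j \in S).
have t0 : 0 <= t by exact: w0.
(* Subtracting [t] on the whole support lowers the maximum of every bucket that meets [S] by at
   least [t]. *)
have mxS b : mx b w' + [exists j in S, adj b j]%:R * t <= mx b w.
  have mxz : [exists j in S, adj b j]%:R * t <= mx b w.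
    case: (boolP [exists j in S, adj b j]) => [/exists_inP[j jS bj]|]; rewrite ?mul0r //.
    rewrite mul1r; apply: (@le_trans _ _ (w j)); last exact: le_bigmax_cond.
    by rewrite j1min //; rewrite inE in jS.
  have [->|[j bj ->]] := mxP b w'; first by rewrite add0r.
  case: (boolP (j \in S)) => jS; last first.
    by move: jS; rewrite inE negbK => wj; rewrite {1}/w' wj /= add0r.
  apply: (@le_trans _ _ (w j)); last exact: le_bigmax_cond.
  rewrite wE jS mul1r lerD2l; case: [exists _ in _, _]; rewrite ?mul1r ?mul0r //.
have := ler_sum (index_enum B) (fun b (_ : xpredT b) => mxS b).
rewrite big_split /= -mulr_suml -natr_sum.
have -> : (\sum_b [exists j in S, adj b j] = #|[set b | [exists j in S, adj b j]]|)%N.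
  by rewrite cardsE -sum1_card [RHS]big_mkcond; apply: eq_bigr => b _; rewrite unfold_in; case: ifP.
have : 7 * (#|S|%:R * L%:R) <= 8 * #|[set b | [exists j in S, adj b j]]|%:R :> R.
  by rewrite -!natrM ler_nat; apply: (expP.2).
move=> h1 h2.
have h3 : 7 * (#|S|%:R * L%:R) * t <= 8 * #|[set b | [exists j in S, adj b j]]|%:R * t.
  by rewrite ler_wpM2r.
move: IH' h2 h3; rewrite !mulrDr; lra.
Qed.

(** By the triangle inequality a bucket sum is at least twice the largest absolute value in the
    bucket minus the sum of all of them. Adding over the buckets, [expander_max] yields
    [(7/4 - 1) L] times the norm. *)
Lemma expander_l1 (z : J -> R) : (#|[set j | z j != 0%R]| <= s)%N ->
  3 * L%:R * \sum_j `|z j| <= 4 * \sum_b `|\sum_(j | adj b j) z j|.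
Proof.
move=> zs; pose w j := `|z j|.
have := @expander_max w (fun j => normr_ge0 _).
have -> : [set j | w j != 0] = [set j | z j != 0].
  by apply/setP => j; rewrite !inE normr_eq0.
move=> /(_ zs) hmax.
have pt b : 2 * mx b w - \sum_(j | adj b j) w j <= `|\sum_(j | adj b j) z j|.
  have [->|[j bj ->]] := mxP b w.
    rewrite mulr0 add0r (le_trans _ (normr_ge0 _)) // oppr_le0 sumr_ge0 // => j _.
    exact: normr_ge0.
  rewrite (bigD1 j) //= [X in _ <= `|X|](bigD1 j) //=.
  have := ler_norm_sum (index_enum J) z (fun i => adj b i && (i != j)).
  set rest := \sum_(i | _) z i; have := lerB_normD (z j) rest.
  by rewrite -/(w j); lra.
have := ler_sum (index_enum B) (fun b (_ : xpredT b) => pt b).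
rewrite big_split /= -mulr_sumr sumrN.
have -> : \sum_b \sum_(j | adj b j) w j = L%:R * \sum_j w j.
  rewrite (exchange_big_dep xpredT) //= mulr_sumr; apply: eq_bigr => j _.
  by rewrite sumr_const -(expP.1 j) cardsE mulr_natl.
by move: hmax; rewrite /mx; lra.
Qed.

End ExpanderGraph.

(** * The sketch and its residuals *)

Lemma sum_double (V : nmodType) (N : nat) (F : nat -> V) :
  \sum_(r < N.*2) F r = \sum_(b < N) (F b.*2 + F b.*2.+1).
Proof.
elim: N => [|N IH]; first by rewrite !big_ord0.
by rewrite doubleS !big_ord_recr /= IH addrA.
Qed.

Section Sketch.
Variables (R : realType) (N d L s : nat) (adj : 'I_N -> 'I_d -> bool).
Hypothesis expP : expander adj L s.
Hypothesis L0 : (0 < L)%N.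

(** Strictly increasing, so it identifies [j]; the successor keeps it positive and the division by
    [d] keeps the norm of a column bounded. *)
Definition weight (j : 'I_d) : R := j.+1%:R / d%:R.

Lemma weight_gt0 j : 0 < weight j.
Proof. by rewrite divr_gt0 // ltr0n // (leq_ltn_trans _ (ltn_ord j)). Qed.

Lemma weight_le1 j : weight j <= 1.
Proof. by rewrite ler_pdivrMr ?mul1r ?ler_nat // ltr0n (leq_ltn_trans _ (ltn_ord j)). Qed.

Lemma weight_le i j : (weight i <= weight j) = (i <= j)%N.
Proof. by rewrite ler_pM2r ?ler_nat // invr_gt0 ltr0n (leq_ltn_trans _ (ltn_ord j)). Qed.

Fact bucket_subproof (r : 'I_N.*2) : (r./2 < N)%N.
Proof. by rewrite -ltn_double (leq_ltn_trans _ (ltn_ord r)) // -[leqRHS]odd_double_half leq_addl. Qed.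
Definition bucket r := Ordinal (bucket_subproof r).

Fact even_row_subproof (b : 'I_N) : (b.*2 < N.*2)%N.
Proof. by rewrite ltn_double. Qed.
Definition even_row b := Ordinal (even_row_subproof b).

Fact odd_row_subproof (b : 'I_N) : (b.*2.+1 < N.*2)%N.
Proof. by rewrite ltn_Sdouble. Qed.
Definition odd_row b := Ordinal (odd_row_subproof b).

Lemma bucket_even b : bucket (even_row b) = b.
Proof. by apply/val_inj; rewrite /= doubleK. Qed.

Lemma bucket_odd b : bucket (odd_row b) = b.
Proof. by apply/val_inj; rewrite /= uphalf_double. Qed.

Lemma row_cases (r : 'I_N.*2) : r = even_row (bucket r) \/ r = odd_row (bucket r).
Proof.
have := odd_double_half r.
by case: (odd r) => e; [right|left]; apply/val_inj => /=; rewrite -[LHS]e.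
Qed.

Lemma sum_rows (V : nmodType) (F : 'I_N.*2 -> V) :
  \sum_r F r = \sum_b (F (even_row b) + F (odd_row b)).
Proof.
pose G k := if insub k is Some r then F r else 0.
rewrite (eq_bigr (fun r : 'I_N.*2 => G r)) ?sum_double => [|r _].
  by apply: eq_bigr => b _; rewrite /G -[b.*2.+1]/(val (odd_row b)) -[b.*2]/(val (even_row b)) !valK.
by rewrite /G valK.
Qed.

(** Bucket [b] owns row [2b] for the weighted sum and row [2b + 1] for the plain sum. *)
Definition sketch_mx : 'M[R]_(N.*2, d) :=
  \matrix_(r, j) (if adj (bucket r) j then (if odd r then 1 else weight j) else 0).
Local Notation Phi := sketch_mx.

Lemma Phi_even b j : Phi (even_row b) j = if adj b j then weight j else 0.
Proof. by rewrite mxE bucket_even /= odd_double. Qed.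

Lemma Phi_odd b j : Phi (odd_row b) j = if adj b j then 1 else 0.
Proof. by rewrite mxE bucket_odd /= odd_double. Qed.

Lemma Phi_neq0 r j : (Phi r j != 0) = adj (bucket r) j.
Proof.
rewrite mxE; case: ifP; rewrite ?eqxx // => _.
by case: ifP; rewrite ?oner_eq0 // gt_eqF // weight_gt0.
Qed.

Lemma card_rows (P : pred 'I_N.*2) :
  #|[set r | P r]| = (\sum_b (P (even_row b) + P (odd_row b)))%N.
Proof.
by rewrite -(@sum_rows nat (fun r => P r : nat)) cardsE -sum1_card big_mkcond.
Qed.

Lemma card_col j : #|[set r | Phi r j != 0]| = L.*2.
Proof.
rewrite card_rows -(expP.1 j) cardsE -sum1_card -[RHS]mul2n big_distrr [RHS]big_mkcond /=.
apply: eq_bigr => b _; rewrite !Phi_neq0 bucket_even bucket_odd unfold_in.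
by case: adj.
Qed.

Lemma l1norm_sketch_ge (z : 'cV[R]_d) : (nnz z <= s)%N ->
  3 / 4 * L%:R * l1norm z <= l1norm (Phi *m z).
Proof.
move=> zs; have := expander_l1 expP (z := fun j => z j 0) zs.
rewrite /l1norm sum_rows big_split /=.
set S := \sum_(_ < d) _; set T := \sum_b `|\sum_(_ | _) _| => h.
set A := \sum_b _; set A' := (X in _ <= _ + X).
have A0 : 0 <= A by apply: sumr_ge0.
suff -> : A' = T by lra.
apply: eq_bigr => b _; rewrite mxE [in RHS]big_mkcond /=; congr `|_|.
by apply: eq_bigr => j _; rewrite Phi_odd; case: adj; rewrite ?mul1r ?mul0r.
Qed.

Lemma l1norm_sketch_le (z : 'cV[R]_d) : l1norm (Phi *m z) <= 2 * L%:R * l1norm z.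
Proof.
rewrite /l1norm mulr_sumr.
apply: (@le_trans _ _ (\sum_r \sum_j `|Phi r j * z j 0|)).
  by apply: ler_sum => r _; rewrite mxE ler_norm_sum.
rewrite exchange_big /=; apply: ler_sum => j _.
rewrite (eq_bigr (fun r => `|Phi r j| * `|z j 0|)) => [|r _]; last by rewrite normrM.
rewrite -mulr_suml ler_wpM2r //.
rewrite -natrM mul2n -(card_col j) -sum1_card natr_sum [leRHS]big_mkcond /=.
apply: ler_sum => r _; rewrite inE.
case: eqP => [->|_] /=; first by rewrite normr0.
rewrite mxE; case: ifP; rewrite ?normr0 // => _.
by case: ifP; rewrite ?normr1 // ger0_norm ?weight_le1 // ltW ?weight_gt0.
Qed.

(** * Residuals, candidates and the queue invariant *)

Implicit Types (z : 'cV[R]_d) (j : 'I_d) (v : R).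
Local Notation y z r := ((Phi *m z) r 0).

Definition peel z j v := z - v *: delta_mx j 0.
Definition nonzero_rows z := #|[set r | y z r != 0]|.
Definition matched z j v := [set r | (Phi r j != 0) && (y z r == v * Phi r j)].
(** A condition on the sketch alone: the rows of [b] look as if [j] were its only nonzero
    coordinate, which accidental cancellation can also produce. *)
Definition isolated z j v :=
  [set b | [&& adj b j, y z (even_row b) == weight j * v & y z (odd_row b) == v]].

Lemma y_peel z j v r : y (peel z j v) r = y z r - v * Phi r j.
Proof.
rewrite /peel mulmxBr -scalemxAr !mxE; congr (_ - _ * _).
rewrite (bigD1 j) //= big1 => [|i ij]; rewrite !mxE ?eqxx ?mulr1 ?addr0 //.
by rewrite (negPf ij) mulr0.
Qed.

(** Matched rows were nonzero and vanish; only the other rows of the column can become nonzero. With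
    at least [3/2 L] matched among [2 L], the balance is at most [-L]. *)
Lemma nonzero_rows_peel z j v : v != 0 -> (6 * L <= 4 * #|matched z j v|)%N ->
  (nonzero_rows (peel z j v) + L <= nonzero_rows z)%N.
Proof.
move=> v0; have sE (A : {set 'I_N.*2}) : #|A| = (\sum_r (r \in A))%N.
  by rewrite -sum1_card big_mkcond.
suff : (nonzero_rows (peel z j v) + 2 * #|matched z j v| <=
    nonzero_rows z + #|[set r | Phi r j != 0%R]|)%N by rewrite card_col; lia.
rewrite /nonzero_rows !sE big_distrr -!big_split /=; apply: leq_sum => r _.
rewrite !inE y_peel; case: (Phi r j =P 0) => [->|/eqP P0] /=.
  by rewrite mulr0 subr0; lia.
case: (y z r =P v * Phi r j) => [e|_] /=; last by case: eqP => _; case: eqP.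
by rewrite e subrr eqxx mulf_neq0.
Qed.

Lemma nnz_peel z j v : (nnz (peel z j v) <= (nnz z).+1)%N.
Proof.
apply: (@leq_trans #|j |: [set i | z i 0 != 0]|); last first.
  by rewrite cardsU1 -[leqRHS]add1n leq_add2r leq_b1.
apply/subset_leq_card/fintype.subsetP => i.
rewrite !inE /peel !mxE; case: (i =P j) => //= ij.
by rewrite mulr0 subr0.
Qed.

Lemma nonzero_rows_nnz z : (nonzero_rows z <= nnz z * L.*2)%N.
Proof.
have sE (T : finType) (A : {set T}) : #|A| = (\sum_r (r \in A))%N.
  by rewrite -sum1_card big_mkcond.
apply: (@leq_trans (\sum_r \sum_(j in [set j | z j 0%R != 0%R]) (Phi r j != 0%R : nat))%N).
  rewrite /nonzero_rows sE; apply: leq_sum => r _; rewrite inE.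
  case: eqP => //= y0; rewrite lt0n; apply/eqP => s0; apply: y0.
  rewrite mxE big1 // => j _; apply/eqP; rewrite mulf_eq0.
  apply: contra_eqT s0; rewrite negb_or => /andP[p0 z0].
  by rewrite -lt0n (bigD1 j) ?inE //= p0.
rewrite exchange_big /= /nnz -sum_nat_const; apply: leq_sum => j _.
by rewrite -(card_col j) sE; apply: leq_sum => r _; rewrite inE.
Qed.

Lemma isolated_matched z j v : (2 * #|isolated z j v| <= #|matched z j v|)%N.
Proof.
rewrite /matched card_rows cardsE -sum1_card big_distrr big_mkcond /=.
apply: leq_sum => b _; rewrite unfold_in !Phi_even !Phi_odd.
case: adj => //=; rewrite oner_eq0 mulr1 (gt_eqF (weight_gt0 _)) /= mulrC.
by case: eqP => //= _; case: eqP.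
Qed.

(** In a unique neighbour of the support of [z], all terms but one vanish. *)
Lemma exists_isolated z : z != 0 -> (nnz z <= s)%N ->
  exists2 j, z j 0 != 0 & (3 * L <= 4 * #|isolated z j (z j 0%R)|)%N.
Proof.
move=> z0 zs; set S := [set j | z j 0 != 0].
have S0 : S != finset.set0.
  apply: contraNneq z0 => S0; apply/eqP/matrixP => j k; rewrite (ord1 k) mxE.
  by have := finset.in_set0 j; rewrite -S0 inE => /negbFE/eqP.
have [j jS jL] := expander_unique expP S0 zs.
exists j; first by rewrite inE in jS.
apply: (leq_trans jL); rewrite leq_mul2l /=; apply/subset_leq_card/fintype.subsetP => b.
rewrite !inE => /andP[bj /forallP u]; rewrite bj /=.
have zero i : i != j -> adj b i -> z i 0 = 0.
  move=> ij bi; apply/eqP; apply: contraTT ij => zi; rewrite negbK.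
  by have := u i; rewrite inE zi bi.
apply/andP; split; rewrite mxE (bigD1 j) //= big1 ?addr0 => [|i ij];
  rewrite ?Phi_even ?Phi_odd ?bj ?mul1r //;
  by case: ifP => bi; rewrite ?mul0r // (zero i) ?mulr0.
Qed.

(* Buckets outside the queue may be isolated for a candidate [(j, v)], but too
   few of them for its acceptance.  A candidate becomes acceptable only when a
   row changes, and then the bucket of that row is queued again. *)
Definition clean z (q : seq nat) j v := [set b in isolated z j v | (b : nat).*2 \notin q].
Definition worklist z q := forall j v, v != 0 -> (4 * #|clean z q j v| < 3 * L)%N.
(** The guarantee on the search: correct when [r] is the even row of an isolated bucket, arbitrary
    otherwise. *)
Definition proposal z (r : nat) j0 v0 := forall (b : 'I_N) j v,
  v != 0 -> r = b.*2 -> b \in isolated z j v -> j = j0 /\ v = v0.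

Lemma worklist_init z : worklist z (iota 0 N.*2).
Proof.
move=> j v _; rewrite (_ : clean _ _ _ _ = finset.set0) ?cards0 ?muln0 ?muln_gt0 //.
by apply/setP => b; rewrite !inE mem_iota /= ltn_double ltn_ord andbF.
Qed.

(** Dropping [r] matters only to a candidate isolated in its bucket, which must be the rejected one;
    fewer than [3/2 L] matched rows leave it fewer than [3/4 L] isolated buckets. *)
Lemma worklist_reject z r q j0 v0 : proposal z r j0 v0 ->
  (v0 != 0 -> (4 * #|matched z j0 v0| < 6 * L)%N) ->
  worklist z (r :: q) -> worklist z q.
Proof.
move=> prop rej wl j v v0'.
case: (boolP [exists b in isolated z j v, r == b.*2]) => [/exists_inP[b bi /eqP rb]|no].
  have [ej ev] := prop b j v v0' rb bi; subst j0 v0.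
  have : (#|clean z q j v| <= #|isolated z j v|)%N.
    by apply/subset_leq_card/fintype.subsetP => c; rewrite inE => /andP[].
  by have := rej v0'; have := isolated_matched z j v; lia.
apply: leq_ltn_trans (wl j v v0'); rewrite leq_mul2l /=.
apply/subset_leq_card/fintype.subsetP => b; rewrite !inE negb_or.
move=> /andP[bi ->]; rewrite bi andbT; move/exists_inPn: no => /(_ b).
by rewrite inE bi eq_sym => /(_ isT) ->.
Qed.

(** A bucket outside [q'] does not contain [j0], so its rows are unchanged; nor is it the bucket of
    [r] if isolated, since the candidate would then be [j0]. Hence no clean set grows. *)
Lemma worklist_accept z r q q' j0 v0 : proposal z r j0 v0 ->
  {subset q <= q'} -> (forall r' : 'I_N.*2, Phi r' j0 != 0 -> (r' : nat) \in q') ->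
  worklist z (r :: q) -> worklist (peel z j0 v0) q'.
Proof.
move=> prop qq' rows wl j v vn0; apply: leq_ltn_trans (wl j v vn0); rewrite leq_mul2l /=.
apply/subset_leq_card/fintype.subsetP => b; rewrite inE => /andP[bi bq].
have nadj : ~~ adj b j0.
  apply: contra bq => bj; apply: (rows (even_row b)).
  by rewrite Phi_neq0 bucket_even.
move: bi; rewrite inE !y_peel Phi_even Phi_odd (negPf nadj) mulr0 !subr0 => bi.
have bi' : b \in isolated z j v by rewrite inE.
rewrite inE bi' inE negb_or (contra (qq' _) bq) andbT /=.
apply: contra nadj => /eqP rb; have [<- _] := prop b j v vn0 (esym rb) bi'.
by case/and3P: bi.
Qed.

(** With an empty queue every isolated bucket is clean, so the candidate from [exists_isolated]
    would violate the invariant. *)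
Lemma worklist_done z : (nnz z <= s)%N -> worklist z [::] -> z = 0.
Proof.
move=> zs wl; apply/eqP; apply/negPn/negP => z0.
have [j zj] := exists_isolated z0 zs; rewrite leqNgt => /negP; apply.
apply: leq_ltn_trans (wl j _ zj); rewrite leq_mul2l /=.
by apply/subset_leq_card/fintype.subsetP => b; rewrite !inE => ->.
Qed.

(** * Columns as sparse lists *)

Definition col_rows j : seq 'I_N.*2 := [seq r <- enum 'I_N.*2 | Phi r j != 0].

Lemma cscE j : csc Phi j = [seq (val r, Phi r j) | r <- col_rows j].
Proof. by rewrite /csc valK. Qed.

Lemma count_csc j (P : pred (nat * R)) :
  count P (csc Phi j) = #|[set r | (Phi r j != 0) && P (val r, Phi r j)]|.
Proof.
rewrite cscE count_map count_filter -sum1_count big_enum_cond -sum1_card.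
by apply: eq_bigl => r; rewrite inE /= andbC.
Qed.

Lemma size_csc j : size (csc Phi j) = L.*2.
Proof.
rewrite -(count_predT (csc _ _)) count_csc -(card_col j).
by apply: eq_card => r; rewrite !inE andbT.
Qed.

Lemma csc_nth j k : (k < L.*2)%N -> exists2 r : 'I_N.*2,
  Phi r j != 0 & nth (0%N, 0) (csc Phi j) k = (val r, Phi r j).
Proof.
rewrite -(size_csc j) => kL.
have := mem_nth (0%N, 0) kL; rewrite {2}cscE => /mapP[r].
by rewrite mem_filter => /andP[r0 _] e; exists r.
Qed.

Lemma mem_csc j r a : ((val (r : 'I_N.*2), a) \in csc Phi j) = (Phi r j != 0) && (a == Phi r j).
Proof.
rewrite cscE; apply/mapP/andP => [[r' r'l [/val_inj -> ->]]|[r0 /eqP ->]].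
  by move: r'l; rewrite mem_filter => /andP[r0 _].
by exists r => //; rewrite mem_filter r0 mem_enum.
Qed.

(* Even rows come first within a bucket, so the first listed entry of a column
   is its weight. *)
Lemma csc_head j : (nth (0%N, 0) (csc Phi j) 0).2 = weight j.
Proof.
have [|r r0 e] := @csc_nth j 0; first by rewrite double_gt0.
rewrite e /=; have [re|re] := row_cases r; move: (r0); rewrite re.
  by rewrite Phi_even; case: adj; rewrite ?eqxx.
(* An odd row cannot come first: the even row of its bucket is smaller and is listed too. *)
rewrite Phi_neq0 bucket_odd => bj; exfalso.
have /mapP[r' r'l re'] : val (even_row (bucket r)) \in unzip1 (csc Phi j).
  apply/mapP; exists (val (even_row (bucket r)), weight j) => //.
  by rewrite mem_csc Phi_even bj eqxx gt_eqF // weight_gt0.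
have : sorted ltn (unzip1 (csc Phi j)).
  rewrite cscE /unzip1 -map_comp sorted_map.
  apply: sorted_filter; first by move=> a b c; exact: ltn_trans.
  by have := iota_ltn_sorted 0 N.*2; rewrite -val_enum_ord sorted_map.
have : val (even_row (bucket r)) \in unzip1 (csc Phi j) by rewrite re'; apply: map_f.
move: e; case: (csc Phi j) => [|p l] //= -> /=.
rewrite inE re /= (_ : _ == _ = false) /=; last by apply/eqP; lia.
move=> inl /(path.order_path_min ltn_trans)/allP/(_ _ inl) /=.
by rewrite uphalf_double ltnNge leqnSn.
Qed.

End Sketch.

(** * Programs with running times *)

Local Open Scope nat_scope.

Fixpoint csize (c : cmd) : nat :=
  match c with
  | Skip => 1
  | NStore a e => (ncost a + ncost e).+1
  | RStore a e => (ncost a + rcost e).+1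
  | Seq c1 c2 => csize c1 + csize c2
  | If b c1 c2 => (bcost b + csize c1 + csize c2).+1
  | While b c => (bcost b + csize c).+1
  end.

Section Runs.
Variables (R : realType) (M : columns R).
Implicit Types (c : cmd) (s : state R) (k : nat).

(* Running time is measured relative to the length of the program text, so that
   no numerical constant ever has to be computed. *)
Definition runs c k s (Q : state R -> Prop) : Prop :=
  exists t s', [/\ exec M c s t s', t <= csize c * k & Q s'].

Lemma runs_weaken c k k' s (Q Q' : state R -> Prop) :
  runs c k s Q -> k <= k' -> (forall s', Q s' -> Q' s') -> runs c k' s Q'.
Proof.
move=> [t [s' [ex tk q]]] kk QQ'; exists t, s'; split=> //; last exact: QQ'.
by rewrite (leq_trans tk) // leq_mul2l kk orbT.
Qed.

Lemma runs_skip k s (Q : state R -> Prop) : 0 < k -> Q s -> runs Skip k s Q.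
Proof. by move=> k0 q; exists 1, s; split=> //=; [constructor | rewrite mul1n]. Qed.

Lemma runs_nstore a e k s (Q : state R -> Prop) : 0 < k ->
  Q (nupdate s (neval M s a) (neval M s e)) -> runs (NStore a e) k s Q.
Proof. by move=> k0 q; exists (ncost a + ncost e).+1; eexists; split; [constructor | exact: leq_pmulr |]. Qed.

Lemma runs_rstore a e k s (Q : state R -> Prop) : 0 < k ->
  Q (rupdate s (neval M s a) (reval M s e)) -> runs (RStore a e) k s Q.
Proof. by move=> k0 q; exists (ncost a + rcost e).+1; eexists; split; [constructor | exact: leq_pmulr |]. Qed.

Lemma runs_seq c1 c2 k s (Q : state R -> Prop) :
  runs c1 k s (fun s' => runs c2 k s' Q) -> runs (Seq c1 c2) k s Q.
Proof.
move=> [t1 [s1 [ex1 tk1 [t2 [s2 [ex2 tk2 q]]]]]].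
exists (t1 + t2), s2; split=> //; first exact: exec_seq ex1 ex2.
by rewrite /= mulnDl leq_add.
Qed.

Lemma runs_if b c1 c2 k s (Q : state R -> Prop) : 0 < k ->
  (beval M s b -> runs c1 k s Q) -> (~~ beval M s b -> runs c2 k s Q) ->
  runs (If b c1 c2) k s Q.
Proof.
move=> k0 H1 H2; have [t [s' [ex tk q]]] :
    runs (if beval M s b then c1 else c2) k s Q.
  by case: (boolP (beval M s b)) => [/H1|/H2].
exists (bcost b + t).+1, s'; split=> //; first exact: exec_if ex.
have h1 : t <= csize c1 * k + csize c2 * k.
  by apply: leq_trans tk _; case: ifP => _; rewrite ?leq_addr ?leq_addl.
have h2 : bcost b <= bcost b * k by rewrite leq_pmulr.
rewrite /= mulSn !mulnDl; lia.
Qed.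

(** Total correctness with measure [mu]: each pass, test included, fits into the size of the loop
    times [k], and the successor pays for the final failing test. *)
Lemma runs_while b c k s (I : state R -> Prop) (mu : state R -> nat) : 0 < k ->
  (forall s1, I s1 -> beval M s1 b ->
     runs c k s1 (fun s2 => I s2 /\ mu s2 < mu s1)) ->
  I s ->
  runs (While b c) (k * (mu s).+1) s (fun s' => I s' /\ ~~ beval M s' b).
Proof.
move=> k0 Hb; have [n] := ubnP (mu s); elim: n s => // n IH s sn Is.
case: (boolP (beval M s b)) => bs; last first.
  exists (bcost b).+1, s; split=> //; first exact: exec_while_false.
  by rewrite /= mulnA (leq_trans _ (leq_pmulr _ _)) // mulSn mulnDl;
     have := leq_pmulr (bcost b) k0; lia.
have [t [s1 [ex tk [I1 m1]]]] := Hb s Is bs.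
have [t' [s2 [ex' tk' q]]] := IH s1 (leq_trans m1 sn) I1.
exists (bcost b + t + t').+1, s2; split=> //; first exact: exec_while_true ex ex'.
have h2 := leq_pmulr (bcost b) k0.
rewrite mulnA in tk' *.
set A := _ * k in tk' *.
have hA : (bcost b + t).+1 <= A by rewrite /A /= mulSn mulnDl; lia.
have : A * (mu s1).+1 <= A * mu s by rewrite leq_mul2l m1 orbT.
by rewrite mulnS; lia.
Qed.

End Runs.

(** * The decoder *)

(* Natural memory: cell 0 holds the address of a frame, in which four unbounded
   arrays are interleaved.  The cells between 0 and the frame are reserved for
   the indices to be output. *)
Inductive region := RVar | RFlag | RTab | RQueue.

Definition rcode r : nat :=
  match r with RVar => 0 | RFlag => 1 | RTab => 2 | RQueue => 3 end.

Definition same r r' := rcode r == rcode r'.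

(** The frame plus [4 e + rcode r]; [4 e] is spelled out by additions because naturals cannot be
    multiplied. *)
Definition addr r e : nexpr :=
  NAdd (NMem (NConst 0))
    (NAdd (NAdd (NAdd e e) (NAdd e e)) (NConst (rcode r))).
Definition Cell r e : nexpr := NMem (addr r e).
Definition V c : nexpr := Cell RVar (NConst c).
Definition SetV c e : cmd := NStore (addr RVar (NConst c)) e.
Definition Frame : nexpr := NMem (NConst 0).
Definition IncV c : cmd := SetV c (NAdd (V c) (NConst 1)).

(** [vK] is the number of tabulated powers of two and [vp] the next power; [vhead] and [vtail]
    delimit the live queue; [vlen] is the length of the output. *)
Local Notation vd := 0 (only parsing).
Local Notation vn := 1 (only parsing).
Local Notation vK := 2 (only parsing).
Local Notation vp := 3 (only parsing).
Local Notation vhead := 4 (only parsing).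
Local Notation vtail := 5 (only parsing).
Local Notation vrow := 6 (only parsing).
Local Notation vj := 7 (only parsing).
Local Notation vi := 8 (only parsing).
Local Notation vcnt := 9 (only parsing).
Local Notation vlen := 10 (only parsing).

(* The frame starts at [d + n + 3], beyond the sketch, which occupies the real
   cells below [n], and beyond the output, which is at most [d] long. *)
Definition setup : cmd :=
  let D := NMem (NConst 0) in let N := NMem (NConst 2) in
  Seq (NStore (NAdd (NAdd D N) (NConst 3)) D)
 (Seq (NStore (NAdd (NAdd D N) (NConst 7)) N)
 (Seq (NStore (NConst 0) (NAdd (NAdd D N) (NConst 3)))
      (SetV vp (NConst 1)))).

(** Powers of two are tabulated by doubling, as the machine cannot halve a step length. *)
Definition table_step : cmd :=
  Seq (NStore (addr RTab (V vK)) (V vp))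
 (Seq (SetV vp (NAdd (V vp) (V vp)))
      (IncV vK)).

Definition make_table : cmd := While (NLt (V vp) (V vd)) table_step.

Definition queue_step : cmd :=
  Seq (NStore (addr RQueue (V vtail)) (V vtail)) (IncV vtail).

Definition make_queue : cmd := While (NLt (V vtail) (V vn)) queue_step.

(* The proposed value is kept in the real cell whose address is the frame, and
   the current estimate of coordinate [j] in the [j.+1]-st cell after it. *)
Definition Val : rexpr := RMem Frame.
Definition xaddr : nexpr := NAdd Frame (NAdd (V vj) (NConst 1)).

(** After an even row comes the plain sum of the same bucket, which is the proposed value; an odd
    row gives an arbitrary proposal, left to the acceptance test. *)
Definition pop : cmd :=
  Seq (SetV vrow (Cell RQueue (V vhead)))
 (Seq (IncV vhead)
 (Seq (RStore Frame (RMem (NAdd (V vrow) (NConst 1))))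
 (Seq (SetV vj (NConst 0))
      (SetV vi (V vK))))).

(** The index is built from its highest bit down; a bit is kept if the weight of the enlarged index,
    first in its column, does not exceed the ratio of the two rows. *)
Definition search : cmd :=
  let j' := NAdd (V vj) (Cell RTab (V vi)) in
  While (NLt (NConst 0) (V vi))
    (Seq (SetV vi (NSub (V vi) (NConst 1)))
         (If (BAnd (NLt j' (V vd))
                (BNot (RLt (RDiv (RMem (V vrow)) Val) (ColVal j' (NConst 0)))))
            (SetV vj j') Skip)).

Definition count_step : cmd :=
  let a := RMem (ColRow (V vj) (V vi)) in
  let b := RMul Val (ColVal (V vj) (V vi)) in
  Seq (If (BAnd (BNot (RLt a b)) (BNot (RLt b a))) (IncV vcnt) Skip) (IncV vi).

Definition count_matches : cmd :=
  Seq (SetV vcnt (NConst 0))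
 (Seq (SetV vi (NConst 0))
      (While (NLt (V vi) (ColSize (V vj))) count_step)).

(** Equality of reals is the negation of both strict comparisons. The count test is [4 vcnt >= 3 D],
    where [D] will be [2 L]. *)
Definition accepts : bexpr :=
  let c := V vcnt in let D := ColSize (V vj) in
  BAnd (BNot (BAnd (BNot (RLt Val (RConst 0))) (BNot (RLt (RConst 0) Val))))
       (BNot (NLt (NAdd (NAdd c c) (NAdd c c)) (NAdd D (NAdd D D)))).

(** A coordinate may be peeled repeatedly: its estimate accumulates, while the flag lets its index
    be listed only once. *)
Definition record : cmd :=
  Seq (RStore xaddr (RAdd (RMem xaddr) Val))
      (If (NLt (Cell RFlag (V vj)) (NConst 1))
         (Seq (NStore (addr RFlag (V vj)) (NConst 1))
         (Seq (IncV vlen)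
              (NStore (V vlen) (V vj))))
         Skip).

Definition subtract_step : cmd :=
  let r := ColRow (V vj) (V vi) in
  Seq (RStore r (RSub (RMem r) (RMul Val (ColVal (V vj) (V vi)))))
 (Seq (NStore (addr RQueue (V vtail)) r)
 (Seq (IncV vtail)
      (IncV vi))).

Definition subtract : cmd :=
  Seq (SetV vi (NConst 0))
      (While (NLt (V vi) (ColSize (V vj))) subtract_step).

Definition step : cmd :=
  Seq pop (Seq search (Seq count_matches
    (If accepts (Seq record subtract) Skip))).

Definition main_loop : cmd := While (NLt (V vhead) (V vtail)) step.

Definition output_step : cmd :=
  Seq (RStore (V vi) (RMem (NAdd Frame
         (NAdd (NMem (NAdd (V vi) (NConst 1))) (NConst 1)))))
      (IncV vi).

(** Cell 0 holds the frame address until the very end, so the length is stored there last. *)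
Definition write_output : cmd :=
  Seq (SetV vi (NConst 0))
 (Seq (While (NLt (V vi) (V vlen)) output_step)
      (NStore (NConst 0) (V vlen))).

Definition decoder : cmd :=
  Seq setup (Seq make_table (Seq make_queue (Seq main_loop write_output))).

(** * Memory layout and frame conditions *)

Section Blocks.
Variables (R : realType) (M : columns R) (B : nat).
Implicit Types (s : state R) (k : nat).
Local Notation F := B.+1.

Definition cell s r i := nmem s (F + (4 * i + rcode r)).
Definition setc s r i x := nupdate s (F + (4 * i + rcode r)) x.

Lemma neval_cell s r e : nmem s 0 = F ->
  neval M s (Cell r e) = cell s r (neval M s e).
Proof. by move=> h; rewrite /= h /cell; congr (nmem s _); lia. Qed.

Lemma nevalV s c : nmem s 0 = F -> neval M s (V c) = cell s RVar c.
Proof. exact: neval_cell. Qed.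

Lemma nupdate_setc s r i x a : a = F + (4 * i + rcode r) -> nupdate s a x = setc s r i x.
Proof. by move=> ->. Qed.

Lemma cellE s r i : cell s r i = nmem s (F + (4 * i + rcode r)).
Proof. by []. Qed.

Lemma base_setc s r i x : nmem (setc s r i x) 0 = nmem s 0.
Proof. by []. Qed.

Lemma rmem_setc s r i x : rmem (setc s r i x) = rmem s.
Proof. by []. Qed.

Lemma low_setc s r i x a : a <= B -> nmem (setc s r i x) a = nmem s a.
Proof. by move=> aB; rewrite /setc /=; case: eqP => // ?; lia. Qed.

Lemma cell_setc s r i x r' i' : cell (setc s r i x) r' i' =
  if same r' r && (i' == i) then x else cell s r' i'.
Proof.
rewrite /cell /setc /=; have -> : (F + (4 * i' + rcode r') == F + (4 * i + rcode r)) =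
  same r' r && (i' == i) by rewrite /same; case: r; case: r' => /=; lia.
by [].
Qed.

Lemma cell_rupdate s a x r i : cell (rupdate s a x) r i = cell s r i.
Proof. by []. Qed.

Lemma cell_low s a x r i : a <= B -> cell (nupdate s a x) r i = cell s r i.
Proof. by move=> aB; rewrite /cell /=; case: eqP => // ?; lia. Qed.

Lemma runs_setc r e e' k s (Q : state R -> Prop) : 0 < k -> nmem s 0 = F ->
  Q (setc s r (neval M s e) (neval M s e')) -> runs M (NStore (addr r e) e') k s Q.
Proof.
move=> k0 b0 q; apply: runs_nstore => //; move: q.
rewrite /setc /addr /= b0; set a := (X in nupdate _ X _); set a' := (X in _ -> _ (nupdate _ X _)).
by have -> : a = a' by rewrite /a /a'; lia.
Qed.

Lemma runs_setV c e k s (Q : state R -> Prop) : 0 < k -> nmem s 0 = F ->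
  Q (setc s RVar c (neval M s e)) -> runs M (SetV c e) k s Q.
Proof. exact: runs_setc. Qed.

Lemma runs_incV c k s (Q : state R -> Prop) : 0 < k -> nmem s 0 = F ->
  Q (setc s RVar c (cell s RVar c).+1) -> runs M (IncV c) k s Q.
Proof.
by move=> k0 b0 q; apply: runs_setV => //; rewrite -[neval _ _ _]/(neval M s (V c) + 1) nevalV // addn1.
Qed.

Definition frame (vs : seq nat) s s' :=
  [/\ nmem s' 0 = nmem s 0, (forall a, a <= B -> nmem s' a = nmem s a) &
      forall r i, ~~ (same r RVar && (i \in vs)) -> cell s' r i = cell s r i].

Lemma frame_setV vs c x s s' : c \in vs -> frame vs s s' -> frame vs s (setc s' RVar c x).
Proof.
move=> cv [h1 h2 h3]; split=> // [a aB|r i ri]; first by rewrite low_setc ?h2.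
rewrite cell_setc h3 //; case: ifP => // /andP[rr /eqP ii].
by move: ri; rewrite rr ii cv.
Qed.

End Blocks.

(** * Specifications of the parts of the decoder *)

(* Symbolic execution by [/=] has to stop at these. *)
Local Opaque addr Cell V SetV IncV cell setc.

Section Specs.
Variables (R : realType) (M : columns R) (B : nat).
Implicit Types (s : state R) (k : nat).
Local Notation F := B.+1.
Local Notation cell := (@cell R B).
Local Notation setc := (@setc R B).
Local Notation frame := (@frame R B).

Local Notation nV := (@nevalV R M B).
Local Notation rV := (@runs_setV R M B).
Local Notation rI := (@runs_incV R M B).
Local Notation rC := (@runs_setc R M B).
Local Notation nC := (@neval_cell R M B).

Lemma frame_cell vs s s' r i : frame vs s s' -> ~~ (same r RVar && (i \in vs)) ->
  cell s' r i = cell s r i.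
Proof. by case=> _ _ h /h. Qed.

Lemma frame_base vs s s' : frame vs s s' -> nmem s 0 = F -> nmem s' 0 = F.
Proof. by case=> -> _ _. Qed.

Lemma search_spec s d K (g : nat -> R) :
  nmem s 0 = F -> cell s RVar vd = d -> cell s RVar vi = K -> cell s RVar vj = 0 ->
  0 < d <= 2 ^ K -> (forall i, i < K -> cell s RTab i = 2 ^ i) ->
  (forall j, j < d -> (nth (0, 0%R) (M j) 0).2 = g j) ->
  (forall i j, i < d -> j < d -> (g i <= g j)%R = (i <= j)) ->
  runs M search K.+1 s (fun s' =>
    [/\ frame [:: vj; vi] s s', rmem s' = rmem s, cell s' RVar vj < d
      & forall j, j < d -> g j = (rmem s (cell s RVar vrow) / rmem s F)%R ->
          cell s' RVar vj = j]).
Proof.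
move=> b0 sd si sj /andP[d0 dK] tab Mg gle.
set rho := (rmem s _ / _)%R.
(* An index whose weight is exactly the ratio, if there is one, stays in the interval of length
   [2 ^ vi] starting at [vj]; each pass halves it. *)
pose I s1 := [/\ frame [:: vj; vi] s s1, rmem s1 = rmem s, cell s1 RVar vi <= K,
  cell s1 RVar vj < d & forall j, j < d -> g j = rho ->
    cell s1 RVar vj <= j < cell s1 RVar vj + 2 ^ cell s1 RVar vi].
have I0 : I s by rewrite /I si sj; split=> // j jd _; rewrite add0n (leq_trans jd dK).
have : runs M search (1 * K.+1) s (fun s' => I s' /\
    ~~ beval M s' (NLt (NConst 0) (V vi))).
  rewrite -{1}si; apply: (runs_while (mu := fun s1 => cell s1 RVar vi)) => // s1 [fr rm iK jd Ij].
  have b1 := frame_base fr b0.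
  rewrite /= nV // => i0; apply/runs_seq/rV => //=.
  rewrite nV //; set i := cell s1 RVar vi in iK Ij i0 *.
  set s2 := setc s1 RVar vi (i - 1).
  have b2 : nmem s2 0 = F by rewrite base_setc.
  have fr2 : frame [:: vj; vi] s s2 by apply: frame_setV.
  have j2 : cell s2 RVar vj = cell s1 RVar vj by rewrite cell_setc.
  have i2 : cell s2 RVar vi = i.-1 by rewrite cell_setc /= subn1.
  have d2 : cell s2 RVar vd = d by rewrite (frame_cell fr2).
  have r2 : cell s2 RVar vrow = cell s RVar vrow by rewrite (frame_cell fr2).
  have t2 : cell s2 RTab i.-1 = 2 ^ i.-1 by rewrite (frame_cell fr2) // tab //; lia.
  have pw : 2 ^ i = 2 ^ i.-1 + 2 ^ i.-1 by rewrite addnn -mul2n -expnS prednK.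
  set pos := cell s1 RVar vj in jd Ij j2.
  apply: runs_if => //=; rewrite !nV // nC // nV // d2 j2 i2 t2 b2 r2 /= rm.
    move=> /andP[pd]; rewrite Mg // -leNgt -/rho => grho.
    apply: rV => //=.
    rewrite nV // nC // nV // i2 j2 t2.
    split; last by rewrite cell_setc /= i2; lia.
    split; rewrite ?cell_setc //=; first exact: frame_setV.
    - by lia.
    - move=> j jd' gj; rewrite subn1; have := Ij j jd' gj; rewrite pw.
      by move: grho; rewrite -gj gle // => ->; lia.
  move=> npos; apply: runs_skip => //; split; last by rewrite i2; lia.
  split=> //; rewrite ?i2 ?j2 //; first by lia.
  move=> j jd' gj; have /andP[h1 h2] := Ij j jd' gj; rewrite h1 /=.
  move: npos; rewrite negb_and -leqNgt => /orP[|]; first by lia.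
  case: (ltnP (pos + 2 ^ i.-1) d) => [pd|pd _]; last by lia.
  by rewrite Mg // -leNgt -/rho -gj gle // -ltnNge.
rewrite mul1n => h; apply: (runs_weaken h) => // s1 [[fr rm iK jd Ij]].
have b1 := frame_base fr b0.
rewrite /= nV // -leqNgt leqn0 => /eqP i0; split=> // j jd' gj.
by have := Ij j jd' gj; rewrite i0; lia.
Qed.

Lemma count_spec s j :
  nmem s 0 = F -> cell s RVar vj = j ->
  runs M count_matches (size (M j)).+1 s (fun s' =>
    [/\ frame [:: vcnt; vi] s s', rmem s' = rmem s
      & cell s' RVar vcnt = count (fun p => rmem s p.1 == rmem s F * p.2)%R (M j)]).
Proof.
move=> b0 sj; pose P (p : nat * R) := rmem s p.1 == (rmem s F * p.2)%R.
apply/runs_seq/rV => //=; apply/runs_seq/rV => //=.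
set s0 := setc (setc s _ _ _) _ _ _.
have b00 : nmem s0 0 = F by rewrite !base_setc.
pose I s1 := [/\ frame [:: vcnt; vi] s s1, rmem s1 = rmem s, cell s1 RVar vi <= size (M j)
  & cell s1 RVar vcnt = count P (take (cell s1 RVar vi) (M j))].
have i0 : cell s0 RVar vi = 0 by rewrite cell_setc.
have I0 : I s0.
  split=> //; first by apply: frame_setV => //; apply: frame_setV.
    by rewrite i0.
  by rewrite i0 take0 !cell_setc.
have := @runs_while _ M (NLt (V vi) (ColSize (V vj))) count_step 1 s0 I
  (fun s1 => size (M j) - cell s1 RVar vi) isT.
rewrite i0 subn0 mul1n => h; apply: (runs_weaken (h _ I0)) => // {h}; last first.
  move=> s1 [[fr rm iM cM]]; rewrite /= !nV ?(frame_base fr b0) //.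
  rewrite (frame_cell fr (i := vj)) // sj -leqNgt => Mi; split=> //.
  by rewrite cM take_oversize.
move=> s1 [fr rm iM cM]; have b1 := frame_base fr b0.
rewrite /= !nV // (frame_cell fr (i := vj)) // sj => iM'.
have key s2 : frame [:: vcnt; vi] s s2 -> rmem s2 = rmem s ->
    cell s2 RVar vi = cell s1 RVar vi ->
    cell s2 RVar vcnt = count P (take (cell s1 RVar vi).+1 (M j)) ->
    runs M (IncV vi) 1 s2 (fun s3 => I s3 /\
     size (M j) - cell s3 RVar vi < size (M j) - cell s1 RVar vi).
  move=> fr2 rm2 i2 c2; apply: rI => //; first exact: frame_base fr2 b0.
  split; last by rewrite !cell_setc /= i2; lia.
  by split; rewrite ?cell_setc //= ?i2 //; apply: frame_setV.
have tk : count P (take (cell s1 RVar vi).+1 (M j)) =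
    cell s1 RVar vcnt + P (nth (0, 0%R) (M j) (cell s1 RVar vi)).
  by rewrite (take_nth (0, 0%R)) // -cats1 count_cat /= addn0 cM.
apply/runs_seq/runs_if => //=; rewrite !nV // (frame_cell fr (i := vj)) // sj b1 rm.
  rewrite -!leNgt -eq_le => e; apply: rI => //.
  apply: key; rewrite ?cell_setc //=; first exact: frame_setV.
  by rewrite tk /P eq_sym e addn1.
rewrite -!leNgt -eq_le => e; apply: runs_skip => //; apply: key => //.
by rewrite tk /P eq_sym (negPf e) addn0.
Qed.

Definition keeps (P : region -> nat -> bool) s s' :=
  (forall a, a <= B -> nmem s' a = nmem s a) /\
  (forall r i, P r i -> cell s' r i = cell s r i).

Lemma keeps_base P s s' : keeps P s s' -> nmem s 0 = F -> nmem s' 0 = F.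
Proof. by case=> h _ <-; exact: h. Qed.

Lemma keeps_setc (P : region -> nat -> bool) s s' r i x :
  ~~ P r i -> keeps P s s' -> keeps P s (setc s' r i x).
Proof.
move=> Pri [h1 h2]; split=> [a aB|r' i' P']; first by rewrite low_setc ?h1.
rewrite cell_setc h2 //; case: ifP => // /andP[rr /eqP ii].
have r_ : r' = r by move: rr; rewrite /same; case: (r); case: (r').
by rewrite r_ ii (negPf Pri) in P'.
Qed.

Lemma table_spec s d L :
  nmem s 0 = F -> cell s RVar vd = d -> cell s RVar vp = 1 -> cell s RVar vK = 0 ->
  d <= 2 ^ L ->
  runs M make_table L.+1 s (fun s' =>
    [/\ keeps (fun r i => ~~ same r RTab && ~~ (same r RVar && (i \in [:: vp; vK]))) s s',
        rmem s' = rmem s, cell s' RVar vK <= L, d <= 2 ^ cell s' RVar vK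
      & forall i, i < cell s' RVar vK -> cell s' RTab i = 2 ^ i]).
Proof.
move=> b0 sd sp sK dL; pose P r i := ~~ same r RTab && ~~ (same r RVar && (i \in [:: vp; vK])).
pose I s1 := [/\ keeps P s s1, rmem s1 = rmem s, cell s1 RVar vK <= L,
  cell s1 RVar vp = 2 ^ cell s1 RVar vK
  & forall i, i < cell s1 RVar vK -> cell s1 RTab i = 2 ^ i].
have I0 : I s by split; rewrite ?sK ?sp.
have := @runs_while _ M (NLt (V vp) (V vd)) table_step 1 s I
  (fun s1 => L - cell s1 RVar vK) isT.
rewrite sK subn0 mul1n => h; apply: (runs_weaken (h _ I0)) => // {h}; last first.
  move=> s1 [[kp rm KL pE tb]]; rewrite /= !nV ?(keeps_base kp b0) // -leqNgt.
  by rewrite (kp.2 _ vd) // sd pE => dK; split.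
move=> s1 [kp rm KL pE tb]; have b1 := keeps_base kp b0.
rewrite /= !nV // (kp.2 _ vd) // sd pE => pd.
(* Inside the loop [2 ^ vK < d <= 2 ^ L], so at most [L] powers are tabulated. *)
have KL' : cell s1 RVar vK < L by rewrite -(ltn_exp2l _ _ (isT : 1 < 2)) (leq_trans pd).
apply/runs_seq/rC => //=; rewrite !nV //.
apply/runs_seq/rV => //=; rewrite !nV ?base_setc // !cell_setc /=.
apply: rI; rewrite ?base_setc // !cell_setc /=.
split; last by rewrite ?cell_setc /=; lia.
split; rewrite ?cell_setc //=; first by do 3!apply: keeps_setc => //.
  by rewrite pE addnn -mul2n expnS.
by move=> i iK; rewrite !cell_setc /= ltnS in iK *; case: eqP => [->//|ne]; apply: tb; lia.
Qed.

Lemma queue_spec s n :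
  nmem s 0 = F -> cell s RVar vn = n -> cell s RVar vtail = 0 ->
  runs M make_queue n.+1 s (fun s' =>
    [/\ keeps (fun r i => ~~ same r RQueue && ~~ (same r RVar && (i == vtail))) s s',
        rmem s' = rmem s, cell s' RVar vtail = n
      & forall i, i < n -> cell s' RQueue i = i]).
Proof.
move=> b0 sn st; pose P r i := ~~ same r RQueue && ~~ (same r RVar && (i == vtail)).
pose I s1 := [/\ keeps P s s1, rmem s1 = rmem s, cell s1 RVar vtail <= n
  & forall i, i < cell s1 RVar vtail -> cell s1 RQueue i = i].
have I0 : I s by split; rewrite ?st.
have := @runs_while _ M (NLt (V vtail) (V vn)) queue_step 1 s I
  (fun s1 => n - cell s1 RVar vtail) isT.
rewrite st subn0 mul1n => h; apply: (runs_weaken (h _ I0)) => // {h}; last first.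
  move=> s1 [[kp rm tn qE]]; rewrite /= !nV ?(keeps_base kp b0) // -leqNgt.
  rewrite kp.2 // sn => nt; have tE : cell s1 RVar vtail = n by apply/eqP; rewrite eqn_leq tn nt.
  by split=> // i; rewrite -tE; apply: qE.
move=> s1 [kp rm tn qE]; have b1 := keeps_base kp b0.
rewrite /= !nV // (kp.2 _ vn) // sn => tn'.
apply/runs_seq/rC => //=; rewrite !nV //.
apply: rI; rewrite ?base_setc // !cell_setc /=.
split; last by rewrite ?cell_setc /=; lia.
split; rewrite ?cell_setc //=; first by do 2!apply: keeps_setc => //.
by move=> i it; rewrite !cell_setc /= ltnS in it *; case: eqP => [//|ne]; apply: qE; lia.
Qed.

Definition listed s (l : seq nat) :=
  [/\ cell s RVar vlen = size l, forall i, i < size l -> nmem s i.+1 = nth 0 l i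
    & forall j, (0 < cell s RFlag j) = (j \in l)].

Lemma keeps_listed (P : region -> nat -> bool) s s' l : size l <= B -> P RVar vlen -> (forall j, P RFlag j) ->
  keeps P s s' -> listed s l -> listed s' l.
Proof.
move=> lB Pl Pf [k1 k2] [h1 h2 h3]; split; first by rewrite k2.
  by move=> i il; rewrite k1 ?h2 // (leq_trans il).
by move=> j; rewrite k2.
Qed.

Lemma record_spec s j l d :
  nmem s 0 = F -> cell s RVar vj = j -> j < d -> d <= B ->
  uniq l -> all (fun i => i < d) l -> listed s l ->
  runs M record 1 s (fun s' => exists l',
    [/\ uniq l', all (fun i => i < d) l', listed s' l',
        forall i, (i \in l') = (i == j) || (i \in l)
      & [/\ nmem s' 0 = F, size l' <= (size l).+1,
            forall r i, ~~ same r RFlag -> ~~ (same r RVar && (i == vlen)) ->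
              cell s' r i = cell s r i
          & forall a, rmem s' a =
              (if (a == F + j.+1)%N then rmem s (F + j.+1)%N + rmem s F else rmem s a)%R]]).
Proof.
move=> b0 sj jd dB ul al [lE nE fE].
apply/runs_seq/runs_rstore => //=; rewrite !nV // sj addn1 b0.
set s1 := rupdate _ _ _.
have b1 : nmem s1 0 = F by [].
apply: runs_if => //=; rewrite nC // nV // !cell_rupdate sj ltnS leqn0.
  rewrite -[_ == 0]negbK -lt0n fE => jl.
  (* A list of distinct indices below [d] has length at most [d], so the output cells stay below the
     frame. *)
  have sz : size (rcons l j) <= d.
    rewrite -[leqRHS](size_iota 0); apply: uniq_leq_size; first by rewrite rcons_uniq jl.
    by move=> i; rewrite mem_rcons inE mem_iota /= add0n => /predU1P[->//|/(allP al)].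
  rewrite size_rcons in sz; have lB : (size l).+1 <= B := leq_trans sz dB.
  apply/runs_seq/rC => //=; rewrite nV // cell_rupdate sj.
  apply/runs_seq/rI; rewrite ?base_setc // !cell_setc /= cell_rupdate lE.
  apply: runs_nstore => //; rewrite !nV ?base_setc // !cell_setc /= cell_rupdate sj.
  set s2 := setc _ _ _ _.
  have c2 r i : cell (nupdate s2 (size l).+1 j) r i = cell s2 r i by apply: cell_low.
  exists (rcons l j); split.
  - by rewrite rcons_uniq jl.
  - by rewrite all_rcons jd.
  - split; rewrite ?c2 ?cell_setc ?size_rcons //=.
      move=> i; rewrite ltnS => il /=; rewrite nth_rcons eqSS; case: eqP => [->|ne].
        by rewrite ltnn.
      have il' : i < size l by rewrite ltn_neqAle il andbT; apply/eqP.
      by rewrite il' !low_setc ?nE //; apply: leq_trans lB; apply: ltnW.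
    move=> i; rewrite c2 !cell_setc /= cell_rupdate mem_rcons inE -fE.
    by case: eqP.
  - by move=> i; rewrite mem_rcons inE.
  - split; [by [] | by rewrite size_rcons | move=> r i rf rv | by move=> a; rewrite /= /s2 !rmem_setc].
    rewrite c2 !cell_setc cell_rupdate.
    by rewrite (negPf rv) (negPf rf).
rewrite -lt0n fE => jl; apply: runs_skip => //; exists l; split=> //.
by move=> i; case: eqP => // ->.
Qed.

Lemma subtract_spec s j :
  nmem s 0 = F -> cell s RVar vj = j -> all (fun p => p.1 <= B) (M j) ->
  runs M subtract (size (M j)).+1 s (fun s' =>
    [/\ keeps (fun r i => ~~ same r RQueue && ~~ (same r RVar && (i \in [:: vi; vtail]))) s s',
        cell s' RVar vtail = cell s RVar vtail + size (M j),
        forall i, i < cell s RVar vtail -> cell s' RQueue i = cell s RQueue i,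
        forall i, i < size (M j) ->
          cell s' RQueue (cell s RVar vtail + i) = (nth (0, 0%R) (M j) i).1
      & forall a, rmem s' a =
          (rmem s a - rmem s F * \sum_(p <- M j | p.1 == a) p.2)%R]).
Proof.
move=> b0 sj lo; pose P r i := ~~ same r RQueue && ~~ (same r RVar && (i \in [:: vi; vtail])); set t0 := cell s RVar vtail.
apply/runs_seq/rV => //=; set s0 := setc _ _ _ _.
have b00 : nmem s0 0 = F by rewrite base_setc.
pose I s1 := [/\ keeps P s s1, cell s1 RVar vi <= size (M j),
  cell s1 RVar vtail = t0 + cell s1 RVar vi,
  forall i, i < t0 + cell s1 RVar vi -> cell s1 RQueue i =
    if i < t0 then cell s RQueue i else (nth (0, 0%R) (M j) (i - t0)).1
  & forall a, rmem s1 a =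
    (rmem s a - rmem s F * \sum_(p <- take (cell s1 RVar vi) (M j) | p.1 == a) p.2)%R].
have i0 : cell s0 RVar vi = 0 by rewrite cell_setc.
have I0 : I s0.
  split; rewrite ?i0 ?addn0 ?cell_setc //; first exact: keeps_setc.
    by move=> i it; rewrite cell_setc it.
  by move=> a; rewrite take0 big_nil mulr0 subr0.
have := @runs_while _ M (NLt (V vi) (ColSize (V vj))) subtract_step 1 s0 I
  (fun s1 => size (M j) - cell s1 RVar vi) isT.
rewrite i0 subn0 mul1n => h; apply: (runs_weaken (h _ I0)) => // {h}; last first.
  move=> s1 [[kp iM tE qE rE]]; rewrite /= !nV ?(keeps_base kp b0) // -leqNgt.
  rewrite (kp.2 _ vj) // sj => Mi.
  have iE : cell s1 RVar vi = size (M j) by apply/eqP; rewrite eqn_leq iM Mi.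
  rewrite iE in tE qE rE; split=> // [i it|i im|a].
  - by rewrite qE ?it // (leq_trans it) // leq_addr.
  - by rewrite qE ?ltn_add2l // ltnNge leq_addr /= addKn.
  - by rewrite rE take_size.
move=> s1 [kp iM tE qE rE]; have b1 := keeps_base kp b0.
rewrite /= !nV // (kp.2 _ vj) // sj => iM'.
set p := nth (0, 0%R) (M j) (cell s1 RVar vi).
have pB : p.1 <= B by apply: (allP lo); apply: mem_nth.
(* All rows are at most [B], so the subtractions never overwrite the proposed value in cell [F]. *)
have vE : rmem s1 F = rmem s F.
  rewrite rE big1_seq ?mulr0 ?subr0 // => q /andP[/eqP qF /mem_take /(allP lo)].
  by rewrite qF ltnn.
apply/runs_seq/runs_rstore => //=; rewrite !nV // (kp.2 _ vj) // sj -/p b1.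
set s2 := rupdate _ _ _; have b2 : nmem s2 0 = F by [].
apply/runs_seq/rC => //=; rewrite !nV // !cell_rupdate (kp.2 _ vj) // sj -/p.
apply/runs_seq/rI; rewrite ?base_setc // !cell_setc /= cell_rupdate.
apply/rI; rewrite ?base_setc // !cell_setc /= cell_rupdate.
split; last by rewrite ?cell_setc /=; lia.
split; rewrite ?cell_setc //=.
- by do 3!apply: keeps_setc => //.
- by rewrite ?cell_rupdate tE addnS.
- move=> i it; rewrite !cell_setc /= ?cell_rupdate tE.
  case: eqP => [->|ne]; first by rewrite ltnNge leq_addr /= addKn.
  by apply: qE; lia.
- move=> a; rewrite (take_nth (0, 0%R)) // -cats1 big_cat big_cons big_nil /= -/p.
  transitivity (rmem s2 a); first by [].
  rewrite /s2 /= eq_sym vE !rE; case: eqP => [<-|_]; rewrite ?addr0 //.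
  by rewrite mulrDr opprD addrA.
Qed.

Lemma output_spec s l d :
  nmem s 0 = F -> all (fun i => i < d) l -> size l <= B -> listed s l ->
  runs M write_output (size l).+1 s (fun s' =>
    output s' = [seq (j, rmem s (F + j.+1)) | j <- l]).
Proof.
move=> b0 al lB [lE nE fE].
apply/runs_seq/rV => //=; set s0 := setc _ _ _ _.
have b00 : nmem s0 0 = F by rewrite base_setc.
(* Values are copied to cells below [size l <= B], which leaves the estimates beyond the frame
   intact. *)
pose I s1 := [/\ frame [:: vi] s s1, cell s1 RVar vi <= size l,
  forall i, i < cell s1 RVar vi -> rmem s1 i = rmem s (F + (nth 0 l i).+1)
  & forall a, B < a -> rmem s1 a = rmem s a].
have i0 : cell s0 RVar vi = 0 by rewrite cell_setc.
have I0 : I s0 by split; rewrite ?i0 //; exact: frame_setV.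
apply: runs_seq.
have := @runs_while _ M (NLt (V vi) (V vlen)) output_step 1 s0 I
  (fun s1 => size l - cell s1 RVar vi) isT.
rewrite i0 subn0 mul1n => h; apply: (runs_weaken (h _ I0)) => // {h}; last first.
  move=> s1 [[fr il rE hi]]; have b1 := frame_base fr b0.
  rewrite /= !nV // -leqNgt (frame_cell fr (i := vlen)) // lE => li.
  have iE : cell s1 RVar vi = size l by apply/eqP; rewrite eqn_leq il li.
  apply: runs_nstore => //; rewrite nV // (frame_cell fr (i := vlen)) // lE.
  rewrite /output /=; apply: (@eq_from_nth _ (0, 0%R)); rewrite ?size_map ?size_iota //.
  move=> i il'; rewrite (nth_map 0) ?size_iota // nth_iota // add0n (nth_map 0) //.
  case: fr => _ lo _; rewrite lo ?nE ?rE ?iE //.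
  exact: leq_trans lB.
move=> s1 [fr il rE hi]; have b1 := frame_base fr b0.
rewrite /= !nV // (frame_cell fr (i := vlen)) // lE => il'.
apply/runs_seq/runs_rstore => //=; rewrite !nV // b1 !addn1.
case: (fr) => _ lo _; rewrite lo ?nE //; last exact: leq_trans lB.
set s2 := rupdate _ _ _; have b2 : nmem s2 0 = F by [].
apply/rI; rewrite // ?cell_rupdate; split; last by rewrite ?cell_setc /=; lia.
split; rewrite ?cell_setc //=; first exact: frame_setV.
- move=> i; rewrite ltnS => iv; transitivity (rmem s2 i); first by [].
  rewrite /s2 /=; case: eqP => [->|ne]; first by rewrite hi //; lia.
  by rewrite rE //; lia.
- move=> a Ba; transitivity (rmem s2 a); first by [].
  by rewrite /s2 /=; case: eqP => [e|_]; [lia | exact: hi].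
Qed.

End Specs.

(** * Correctness of the decoder *)

Local Open Scope ring_scope.

Section Decoding.
Variables (R : realType) (N d L m : nat) (adj : 'I_N -> 'I_d -> bool).
Hypothesis expP : expander adj L (3 * m).
Hypothesis L0 : (0 < L)%N.
Hypothesis d0 : (0 < d)%N.
Hypothesis dL : (d <= 2 ^ L)%N.
Variable x : 'cV[R]_d.
Hypothesis xm : (nnz x <= m)%N.

Local Notation Phi := (@sketch_mx R N d adj).
Local Notation n := N.*2.
Local Notation B := (d + n + 2)%N.
Local Notation F := B.+1.
Local Notation cell := (@cell R B).
Local Notation setc := (@setc R B).
Local Notation M := (csc Phi).
Implicit Types (s : state R) (z : 'cV[R]_d).

Lemma sum_csc_row (j : 'I_d) (r : 'I_n) : \sum_(p <- M j | p.1 == r) p.2 = Phi r j.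
Proof.
rewrite cscE big_map big_filter_cond big_enum_cond /=.
case: (Phi r j =P 0) => [e|/eqP ne].
  by rewrite big1 ?e // => i /andP[i0 /eqP/val_inj ir]; move: i0; rewrite ir e eqxx.
rewrite (bigD1 r) /= ?ne ?eqxx // big1 ?addr0 // => i /andP[/andP[_ /eqP/val_inj ->]].
by rewrite eqxx.
Qed.

Lemma sum_csc_out (j : 'I_d) a : (n <= a)%N -> \sum_(p <- M j | p.1 == a) p.2 = 0.
Proof.
move=> na; rewrite cscE big_map big1 // => r /eqP ra.
by have := ltn_ord r; rewrite [X in (X < _)%N]ra ltnNge na.
Qed.

Definition queue s :=
  [seq cell s RQueue i | i <- iota (cell s RVar vhead) (cell s RVar vtail - cell s RVar vhead)].

(* [z] is the part of [x] which is still to be found. *)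
Record invariant s z : Prop := Invariant {
  inv_base : nmem s 0 = F;
  inv_d : cell s RVar vd = d;
  inv_KL : (cell s RVar vK <= L)%N;
  inv_K : (d <= 2 ^ cell s RVar vK)%N;
  inv_tab : forall i, (i < cell s RVar vK)%N -> cell s RTab i = (2 ^ i)%N;
  inv_y : forall r : 'I_n, rmem s r = (Phi *m z) r 0;
  inv_x : forall j : 'I_d, rmem s (F + j.+1)%N = x j 0 - z j 0;
  (* This bound and [inv_budget] are amortized: a subtraction removes at least [L] nonzero rows and
     adds at most one index to [l] and one nonzero coordinate to [z]. *)
  inv_out : exists l, [/\ uniq l, all (fun i => i < d)%N l, listed B s l,
    (size l * L + nonzero_rows adj z <= 2 * m * L)%N
    & forall j : 'I_d, (j : nat) \notin l -> rmem s (F + j.+1)%N = 0];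
  inv_budget : (nnz z * L + nonzero_rows adj z <= 3 * m * L)%N;
  inv_queue : (cell s RVar vhead <= cell s RVar vtail)%N;
  inv_worklist : worklist L adj z (queue s) }.

(** Acceptance pops one row and queues [2 L], but clears at least [L] nonzero rows, so the factor 2
    pays for the new entries. *)
Definition potential s := (cell s RVar vtail - cell s RVar vhead +
  2 * #|[set r : 'I_n | rmem s r != 0%R]|)%N.

Lemma potentialE s z : (forall r : 'I_n, rmem s r = (Phi *m z) r 0) ->
  potential s = (cell s RVar vtail - cell s RVar vhead + 2 * nonzero_rows adj z)%N.
Proof.
move=> yE; congr (_ + 2 * _)%N; rewrite /nonzero_rows; apply: eq_card => r.
by rewrite !inE yE.
Qed.

Lemma pop_spec s : nmem s 0 = F ->
  let r := cell s RQueue (cell s RVar vhead) in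
  runs M pop 1 s (fun s' =>
    [/\ frame B [:: vrow; vhead; vj; vi] s s', cell s' RVar vrow = r,
        cell s' RVar vhead = (cell s RVar vhead).+1,
        cell s' RVar vj = 0%N /\ cell s' RVar vi = cell s RVar vK
      & forall a, rmem s' a = if (a == F)%N then rmem s r.+1 else rmem s a]).
Proof.
move=> b0 r; pose nV := @nevalV R M B; pose nC := @neval_cell R M B.
apply/runs_seq/(@runs_setV R M B) => //; rewrite nC // nV // -/r.
apply/runs_seq/(@runs_incV R M B); rewrite ?base_setc // !cell_setc /=.
apply/runs_seq/runs_rstore => //=; rewrite nV ?base_setc // !cell_setc /= b0 addn1.
set s1 := rupdate _ _ _; have b1 : nmem s1 0 = F by [].
apply/runs_seq/(@runs_setV R M B) => //=.
apply/(@runs_setV R M B); rewrite ?base_setc // nV ?base_setc // !cell_setc /= cell_rupdate.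
rewrite !cell_setc /=; split; rewrite ?(cell_setc, cell_rupdate) //=.
do 2!apply: frame_setV => //.
have : frame B [:: vrow; vhead; vj; vi] s (setc (setc s RVar vrow r) RVar vhead (cell s RVar vhead).+1).
  by do 2!apply: frame_setV => //.
by case=> h1 h2 h3; split.
Qed.

Lemma step_spec s z : invariant s z -> (cell s RVar vhead < cell s RVar vtail)%N ->
  runs M step L.*2.+1 s (fun s' => (exists z', invariant s' z') /\
    (potential s' < potential s)%N).
Proof.
move=> I ht; case: (I) => b0 sd KL dK tab yE xE [l [ul al ll lbud lx]] bud hq wl.
set r := cell s RQueue (cell s RVar vhead).
apply/runs_seq/(runs_weaken (pop_spec b0)) => // s1 [fr1 row1 head1 [j1 i1] rm1].
rewrite -/r in row1 rm1; set v := rmem s r.+1 in rm1.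
have b1 : nmem s1 0 = F := frame_base fr1 b0.
(* The weights as a function on naturals; the default 0 lies outside the range searched. *)
pose g := fun j : nat => if @insub _ _ 'I_d j is Some j' then weight R j' else 0 : R.
have gE (j : 'I_d) : g j = weight R j by rewrite /g valK.
have gord j (jd : (j < d)%N) : g j = weight R (Ordinal jd) by rewrite -gE.
have srch := @search_spec R M B s1 d _ g b1
  (etrans (frame_cell (r := RVar) (i := vd) fr1 isT) sd) i1 j1.
apply/runs_seq/(runs_weaken (srch _ _ _ _)) => {srch}.
- by rewrite d0 dK.
- by move=> i iK; rewrite (frame_cell fr1) // tab.
- by move=> j jd; rewrite gord -(csc_head _ expP L0 (Ordinal jd)).
- by move=> i j id jd; rewrite !gord weight_le.
- by rewrite ltnS (leq_trans KL) // -addnn leq_addr.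
move=> s2 [fr2 rm2 jd jP]; have b2 : nmem s2 0 = F := frame_base fr2 b1.
set j0 := Ordinal jd.
have rowF (a : nat) : (a < n)%N -> (a == F)%N = false by move=> an; apply/eqP; lia.
have yE1 (a : 'I_n) : rmem s1 a = (Phi *m z) a 0 by rewrite rm1 rowF // yE.
have vE : rmem s1 F = v by rewrite rm1 eqxx.
(* In an isolated bucket the odd row is the value and the even row its product with the weight, so
   their ratio is exactly the weight. *)
have prop : proposal adj z r j0 v.
  move=> b j v' v'0 rb; rewrite inE => /and3P[bj /eqP ye /eqP yo].
  have vv : v = v' by rewrite /v rb (yE (odd_row b)) yo.
  split=> //; apply/val_inj/esym => /=; apply: jP => //.
  rewrite gE row1 vE rb (yE1 (even_row b)) ye vv mulfK //.
have Msz : size (M j0) = L.*2 by rewrite (size_csc _ expP).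
apply/runs_seq/(runs_weaken (count_spec M b2 (erefl _))); first by rewrite Msz.
move=> s3 [fr3 rm3]; rewrite rm2 vE.
rewrite (count_csc adj j0) => cnt3.
have {}cnt3 : cell s3 RVar vcnt = #|matched adj z j0 v|.
  rewrite cnt3 /matched; apply: eq_card => a; rewrite !inE /=.
  by rewrite yE1.
have b3 : nmem s3 0 = F := frame_base fr3 b2.
have F3 rg i : ~~ (same rg RVar && (i \in [:: vrow; vhead; vj; vi; vcnt])) ->
    cell s3 rg i = cell s rg i.
  move=> h; rewrite (frame_cell fr3) ?(frame_cell fr2) ?(frame_cell fr1) //;
  by move: h; case: (same _ _) => //=; rewrite !inE; lia.
have head3 : cell s3 RVar vhead = (cell s RVar vhead).+1.
  by rewrite (frame_cell fr3) // (frame_cell fr2).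
have j3 : cell s3 RVar vj = j0 by rewrite (frame_cell fr3).
have low3 a : (a <= B)%N -> nmem s3 a = nmem s a.
  case: (fr3) => _ h _ aB; rewrite h //; case: (fr2) => _ {}h _; rewrite h //.
  by case: (fr1) => _ {}h _; rewrite h.
have rm3' a : rmem s3 a = if (a == F)%N then v else rmem s a by rewrite rm3 rm2 rm1.
have l3 : listed B s3 l.
  case: ll => h1 h2 h3; split; first by rewrite F3.
    move=> i il; rewrite low3 ?h2 //.
    have : (size l <= d)%N.
      rewrite -[leqRHS](size_iota 0); apply: uniq_leq_size => // k kl.
      by rewrite mem_iota (allP al).
    by move=> ld; apply: leq_trans il (leq_trans ld _); lia.
  by move=> j; rewrite F3.
pose q := [seq cell s RQueue i |
    i <- iota (cell s RVar vhead).+1 (cell s RVar vtail - (cell s RVar vhead).+1)].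
have queueE : queue s = r :: q.
  by rewrite /queue -subnSK.
have nV := @nevalV R M B; have nC := @neval_cell R M B.
have potE := potentialE yE.
apply: runs_if => //=; rewrite !nV // cnt3 j3 Msz b3 rm3' eqxx -!leNgt -eq_le.
  move=> /andP[v0 acc].
  have {}acc : (6 * L <= 4 * #|matched adj z j0 v|)%N by lia.
  have {}v0 : v != 0 by rewrite eq_sym.
  have dB : (d <= B)%N by lia.
  apply/runs_seq/(runs_weaken (record_spec M b3 j3 jd dB ul al l3)) => //.
  move=> s4 [l' [ul' al' l4 ml' [b4 sl' F4 rm4]]].
  have j4 : cell s4 RVar vj = j0 by rewrite F4.
  have Mlo : all (fun p => p.1 <= B)%N (M j0).
    apply/allP => p; rewrite cscE => /mapP[a _ ->] /=.
    by have := ltn_ord a; lia.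
  apply: (runs_weaken (subtract_spec b4 j4 Mlo)); first by rewrite Msz.
  move=> s5 [kp5 t5 q5 q5' rm5].
  have v4 : rmem s4 F = v by rewrite rm4 !rm3' eqxx; case: (F =P _) => //; lia.
  have t3 : cell s4 RVar vtail = cell s RVar vtail by rewrite F4 // F3.
  rewrite t3 Msz in t5 q5 q5'; rewrite v4 in rm5.
  have h5 : cell s5 RVar vhead = (cell s RVar vhead).+1 by rewrite kp5.2 // F4.
  set z' := peel z j0 v.
  have y5 (a : 'I_n) : rmem s5 a = (Phi *m z') a 0.
    have an := ltn_ord a.
    rewrite rm5 rm4 !rm3' sum_csc_row y_peel (rowF a) // yE.
    by case: ((a : nat) =P _) => //; lia.
  have wz' := nonzero_rows_peel expP L0 v0 acc.
  have nz' := nnz_peel z j0 v; rewrite -/z' in wz' nz'.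
  have t5' : cell s5 RVar vtail = (cell s RVar vtail + L.*2)%N by [].
  split; last by rewrite potE (potentialE y5) t5' h5; lia.
  exists z'; split=> //.
  - exact: keeps_base kp5 b4.
  - by rewrite kp5.2 // F4 // F3.
  - by rewrite kp5.2 // F4 // F3.
  - by rewrite kp5.2 // F4 // F3.
  - by move=> i; rewrite !kp5.2 // !F4 // !F3 //; apply: tab.
  - move=> j; rewrite rm5 sum_csc_out; last by lia.
    rewrite mulr0 subr0 rm4 !rm3' !mxE eqn_add2l eqSS -[_ == _]/(j == j0).
    case: eqP => [->|_]; rewrite ?eqxx ?mulr1 ?mulr0 ?subr0.
      by case: eqP => [|_]; [lia | rewrite xE; ring].
    by case: eqP => [|_]; [lia | rewrite xE].
  - exists l'; split=> //.
    + apply: keeps_listed kp5 l4 => //.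
      have : (size l' <= d)%N.
        rewrite -[leqRHS](size_iota 0); apply: uniq_leq_size => // k kl.
        by rewrite mem_iota (allP al').
      by move/leq_trans; apply; lia.
    + have : (size l' * L <= (size l).+1 * L)%N by rewrite leq_mul2r sl' orbT.
      by rewrite mulSn; lia.
    + move=> j; rewrite ml' negb_or => /andP[jj jl].
      rewrite rm5 sum_csc_out; last by lia.
      rewrite mulr0 subr0 rm4 !rm3' eqn_add2l eqSS (negPf jj).
      by case: eqP => [|_]; [lia | exact: lx].
  - have : (nnz z' * L <= (nnz z).+1 * L)%N by rewrite leq_mul2r nz' orbT.
    by rewrite mulSn; lia.
  - by rewrite t5' h5; lia.
  - apply: (worklist_accept prop _ _ _ (r := r) (q := q)); last by rewrite -queueE.
      move=> a /mapP[i]; rewrite mem_iota => /andP[i1' i2'] ->; apply/mapP.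
      exists i; first by rewrite mem_iota h5 t5'; lia.
      by rewrite q5 ?F4 ?F3 //; lia.
    move=> a ane; have : (val a, Phi a j0) \in M j0 by rewrite mem_csc ane eqxx.
    move=> /(nthP (0%N, 0))[i il ie]; rewrite Msz in il.
    apply/mapP; exists (cell s RVar vtail + i)%N; first by rewrite mem_iota h5 t5'; lia.
    by rewrite q5' // ie.
move=> rej; apply: runs_skip => //.
have y3 (a : 'I_n) : rmem s3 a = (Phi *m z) a 0 by rewrite rm3' rowF // yE.
have t3 : cell s3 RVar vtail = cell s RVar vtail by rewrite F3.
split; last by rewrite potE (potentialE y3) t3 head3; lia.
exists z; split=> //.
- by rewrite F3.
- by rewrite F3.
- by rewrite F3.
- by move=> i; rewrite !F3 //; apply: tab.
- by move=> j; rewrite rm3'; case: eqP => [|_]; [lia | exact: xE].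
- exists l; split=> // j jl; rewrite rm3'; case: eqP => [|_]; [lia | exact: lx].
- by rewrite head3 t3.
- apply: (worklist_reject L0 prop); last first.
    rewrite (_ : r :: _ = queue s) // queueE /queue head3 t3.
    by congr (_ :: _); apply: eq_map => i; rewrite F3.
  by move=> v0; move: rej; rewrite eq_sym v0 /=; lia.
Qed.

Lemma setup_spec (v : 'cV[R]_n) :
  runs M setup 1 (input d m v) (fun s =>
    [/\ nmem s 0 = F, [/\ cell s RVar vd = d, cell s RVar vn = n & cell s RVar vp = 1%N],
        forall r i, ~~ (same r RVar && (i \in [:: vd; vn; vp])) -> cell s r i = 0%N
      & rmem s = rmem (input d m v)]).
Proof.
set s0 := input d m v.
have c0 r i : cell s0 r i = 0%N by rewrite cellE /= nth_default //=; lia.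
apply/runs_seq/runs_nstore => //=.
rewrite (@nupdate_setc R B s0 RVar vd); last by rewrite /=; lia.
set s1 := setc _ _ _ _.
have lo1 a : (a <= B)%N -> nmem s1 a = nmem s0 a by move=> aB; rewrite low_setc.
apply/runs_seq/runs_nstore => //=; rewrite !lo1 //=; [|by rewrite leq_addl].
rewrite (@nupdate_setc R B s1 RVar vn); last by rewrite /=; lia.
set s2 := setc _ _ _ _.
have lo2 a : (a <= B)%N -> nmem s2 a = nmem s0 a by move=> aB; rewrite low_setc ?lo1.
apply/runs_seq/runs_nstore => //=; rewrite !lo2 //=; [|by rewrite leq_addl].
set s3 := nupdate _ _ _.
have b3 : nmem s3 0 = F by rewrite /=; lia.
have c3 r i : cell s3 r i = cell s2 r i by apply: cell_low.
apply/(@runs_setV R M B) => //=.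
split; [by rewrite base_setc | by split; rewrite ?(cell_setc, c3) | | by rewrite rmem_setc].
move=> r i; rewrite !inE cell_setc c3 !cell_setc c0.
by case: (same r RVar) => //=; case: eqP => //= ?; case: eqP => //= ?; case: eqP.
Qed.

(** The initial potential is the [n] queued rows plus twice at most [2 m L] nonzero rows; each pass
    costs a multiple of [2 L + 1]. *)
Theorem decoder_spec :
  runs M decoder (L.*2.+1 * (n + 4 * m * L).+1) (input d m (Phi *m x))
    (fun s => sparse_repr (output s) x).
Proof.
set k := (_ * _)%N.
have L21 : (0 < L.*2.+1)%N by [].
have nk : (n.+1 <= k)%N by rewrite (@leq_trans (n + 4 * m * L).+1) ?leq_pmull // ltnS leq_addr.
have Lk : (L.+1 <= k)%N by rewrite (@leq_trans L.*2.+1) ?leq_pmulr // ltnS -addnn leq_addr.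
have mk : ((2 * m).+1 <= k)%N.
  rewrite (@leq_trans (n + 4 * m * L).+1) ?leq_pmull // ltnS.
  by rewrite (@leq_trans (4 * m * L)) ?leq_addl // (@leq_trans (4 * m)) ?leq_pmulr //; lia.
apply/runs_seq/(runs_weaken (setup_spec _)) => [|s1 [b1 [d1 n1 p1] z1 r1]]; first by lia.
apply/runs_seq/(runs_weaken (table_spec M b1 d1 p1 (z1 RVar vK isT) dL)) => //.
move=> s2 [kp2 r2 KL2 dK2 tab2].
have b2 : nmem s2 0 = F := keeps_base kp2 b1.
apply/runs_seq/(runs_weaken (@queue_spec R M B s2 n b2 _ _)) => //.
- by rewrite kp2.2.
- by rewrite kp2.2 // z1.
move=> s3 [kp3 r3 t3 q3].
have b3 : nmem s3 0 = F := keeps_base kp3 b2.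
have h3 : cell s3 RVar vhead = 0%N by rewrite kp3.2 // kp2.2 // z1.
have rE a : rmem s3 a = if insub a is Some i then (Phi *m x) i 0 else 0.
  by rewrite r3 r2 r1.
have Wx := nonzero_rows_nnz expP x.
have W2 : (nonzero_rows adj x <= 2 * m * L)%N.
  by apply: (leq_trans Wx); rewrite -muln2 mulnA (leq_trans (leq_mul (leq_mul xm (leqnn L)) (leqnn 2))) //; lia.
have rF a : (n <= a)%N -> rmem s3 a = 0 by move=> na; rewrite rE insubF // ltnNge na.
have inv3 : invariant s3 x.
  split=> //.
  - by rewrite kp3.2 // kp2.2.
  - by rewrite kp3.2.
  - by rewrite kp3.2.
  - by move=> i; rewrite !kp3.2 //; apply: tab2.
  - by move=> r; rewrite rE valK.
  - by move=> j; rewrite rF ?subrr //; lia.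
  - exists [::]; split=> //; last by move=> j _; rewrite rF //; lia.
    split=> //; first by rewrite kp3.2 // kp2.2 // z1.
    by move=> j; rewrite kp3.2 // kp2.2 // z1.
  - have : (nnz x * L <= m * L)%N by rewrite leq_mul2r xm orbT.
    by lia.
  - by rewrite h3.
  - have -> : queue s3 = iota 0 n.
      rewrite /queue h3 t3 subn0 -[RHS]map_id; apply/eq_in_map => i.
      by rewrite mem_iota => /andP[_ im]; rewrite q3.
    exact: worklist_init.
have pot3 : (potential s3 <= n + 4 * m * L)%N.
  by rewrite (potentialE (inv_y inv3)) h3 t3; lia.
pose I s := exists z, invariant s z.
have := @runs_while R M (NLt (V vhead) (V vtail)) step L.*2.+1 s3 I potential isT.
move=> loop; apply: runs_seq; apply: (runs_weaken (loop _ _)) => [s [z inv] ht||| s4 [[z inv] ht]].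
- have b := inv_base inv.
  by apply: step_spec inv _; move: ht; rewrite /= !(@nevalV R M B).
- by exists x.
- by rewrite leq_mul2l ltnS pot3 orbT.
have b4 := inv_base inv.
move: ht; rewrite /= !(@nevalV R M B) // -leqNgt => ht.
(* The budget gives [nnz z <= 3 m], within the range of expansion, and the queue is empty. *)
have z0 : z = 0.
  apply: (worklist_done expP).
    have := inv_budget inv; have : (0 < L)%N := L0.
    move=> _ bud; rewrite -(leq_pmul2r L0); apply: leq_trans bud; exact: leq_addr.
  have := inv_worklist inv; rewrite /queue (_ : (_ - _)%N = 0%N) //.
  by apply/eqP; rewrite subn_eq0.
case: (inv_out inv) => l [ul al ll lbud lx].
have ld : (size l <= d)%N.
  rewrite -[leqRHS](size_iota 0); apply: uniq_leq_size => // i il.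
  by rewrite mem_iota (allP al).
have l2m : (size l <= 2 * m)%N.
  by rewrite -(leq_pmul2r L0); apply: leq_trans lbud; exact: leq_addr.
apply: (runs_weaken (output_spec M b4 al _ ll)); first by apply: leq_trans ld _; lia.
  by rewrite (leq_trans _ mk) // ltnS.
move=> s5 ->; split.
- by rewrite /unzip1 -map_comp map_id_in.
- by rewrite /unzip1 -map_comp map_id_in.
move=> i; rewrite big_map /=.
have xi : x i 0 = rmem s4 (F + i.+1)%N by rewrite (inv_x inv) z0 mxE subr0.
case: (boolP ((i : nat) \in l)) => il; last first.
  rewrite big1_seq => [|j /andP[/eqP ji jl]]; first by rewrite xi lx.
  by rewrite -ji jl in il.
rewrite big_mkcond (bigD1_seq (i : nat) il ul) /= eqxx xi big1 ?addr0 // => j /negPf -> //.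
Qed.

End Decoding.

(** * Choice of parameters and constants *)

Local Open Scope classical_set_scope.
Local Open Scope ring_scope.

(** Each layer has its own [W] buckets, so every coordinate has exactly [L] neighbours; pairs of
    layer and bucket are then numbered. *)
Lemma expander_of_size (d L W s : nat) :
  (0 < W)%N -> (s * 2 ^ 16 <= W)%N -> (2 * d < 2 ^ L)%N ->
  exists adj : 'I_(L * W) -> 'I_d -> bool, expander adj L s.
Proof.
move=> W0 sW dL; have [g gP] := expander_exists W0 sW dL.
have cN : #|{: 'I_L * 'I_W}| = (L * W)%N by rewrite card_prod !card_ord.
pose pr (b : 'I_(L * W)) : 'I_L * 'I_W := enum_val (cast_ord (esym cN) b).
pose rk (p : 'I_L * 'I_W) : 'I_(L * W) := cast_ord cN (enum_rank p).
have prK : cancel pr rk by move=> b; rewrite /rk /pr enum_valK cast_ordKV.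
have rkK : cancel rk pr by move=> p; rewrite /rk /pr cast_ordK enum_rankK.
exists (fun b j => g (j, (pr b).1) == (pr b).2); split=> [j|S Ss].
  have inj : injective (fun l => rk (l, g (j, l))).
    by move=> l l' /(can_inj rkK) [].
  rewrite -[RHS](card_ord L) -(card_imset _ inj); apply: eq_card => b; rewrite inE.
  apply/eqP/imsetP => [e|[l _ ->]]; last by rewrite rkK.
  by exists (pr b).1; rewrite ?inE // e -surjective_pairing prK.
apply: leq_trans (gP S Ss) _; rewrite leq_mul2l /= -(card_imset _ (can_inj rkK)).
apply/subset_leq_card/fintype.subsetP => _ /imsetP[_ /imsetP[[j l] + ->] ->].
rewrite !inE /= andbT => jS; apply/exists_inP; exists j => //.
by rewrite rkK.
Qed.

(** From [exp (-1/2) >= 1 - 1/2]. This lets additive constants be absorbed into logarithms. *)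
Lemma ln_ge_half (R : realType) (k : nat) : (2 <= k)%N -> 1 / 2 <= ln k%:R :> R.
Proof.
move=> k2; apply: (@le_trans _ _ (ln 2)); last first.
  by rewrite ler_ln ?ler_nat // posrE ltr0n // ltnW.
rewrite -ler_expR lnK ?posrE // -[leLHS]invrK -expRN.
have := expR_ge1Dx (- (1 / 2) : R); set b := expR _ => h.
have b0 : 0 < b by exact: expR_gt0.
rewrite -[leRHS]invrK lef_pV2 ?posrE //.
lra.
Qed.

(** As [ln 2 >= 1/2], the truncated logarithm is at most [2 ln k], and the additional 2 is at most
    [4 ln k]. *)
Lemma trunc_log_le_ln (R : realType) (k : nat) : (2 <= k)%N ->
  (trunc_log 2 k).+2%:R <= 6 * ln k%:R :> R.
Proof.
move=> k2; have k0 : (0 < k)%N by rewrite ltnW.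
have h2 := @ln_ge_half R 2 isT; have hk := @ln_ge_half R k k2.
have : ln ((2 ^ trunc_log 2 k)%N%:R) <= ln k%:R :> R.
  by rewrite ler_ln ?ler_nat ?trunc_logP // posrE ltr0n ?expn_gt0.
set e := trunc_log 2 k; rewrite natrX lnXn // -[ln _ *+ _]mulr_natl => h.
have e0 : 0 <= e%:R :> R by [].
by have := ler_wpM2l e0 h2; rewrite -(addn2 e) natrD; lra.
Qed.

Lemma nnzB (R : realType) d (x y : 'cV[R]_d) : (nnz (x - y) <= nnz x + nnz y)%N.
Proof.
rewrite /nnz (leq_trans _ (leq_card_setU _ _)) //; apply/subset_leq_card/fintype.subsetP => i.
rewrite !inE !mxE -negb_and; apply: contra => /andP[/eqP-> /eqP->].
by rewrite subrr.
Qed.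

Theorem theorem1 (R : realType) :
  exists C : R, 0 < C /\
  exists P : cmd,
  forall (d m : nat) (Y : set 'cV[R]_d),
    (2 <= d)%N -> (1 <= m)%N ->
    (forall x, Y x -> (nnz x <= m)%N) ->
  exists (n : nat) (Phi : 'M[R]_(n, d)),
    [/\ n%:R <= C * m%:R * ln d%:R ^+ 2,
        exists A B : R,
          [/\ 0 < A, 0 < B,
              (2 <= m)%N -> B / A <= C * ln d%:R ^+ 2 * ln m%:R ^+ 3
            & forall x y, Y x -> Y y ->
                A * l1norm (x - y) <= l1norm (Phi *m x - Phi *m y) /\
                l1norm (Phi *m x - Phi *m y) <= B * l1norm (x - y)]
      & forall x, Y x ->
          exists (t : nat) (s : state R),
            [/\ exec (csc Phi) P (input d m (Phi *m x)) t s,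
                (2 <= m)%N ->
                  t%:R <= C * m%:R * ln m%:R ^+ 2 * ln d%:R ^+ 2
              & sparse_repr (output s) x]].
Proof.
(* An opaque name prevents [2 ^ 16] from being computed in unary. *)
have [q qE] : exists q, q = (2 ^ 16)%N by exists (2 ^ 16)%N.
pose c : R := (csize decoder)%:R.
have c0 : 0 <= c by [].
have q0 : 0 <= q%:R :> R by [].
(* One summand each for dimension, distortion and time: [72 = 6 * 12] from [n = 6 m q L] and
   [L <= 12 ln^2 d]; [86 >= 8/3 * 32]; [432 = 3 * 144] from [L^2 <= 144 ln^2 m ln^2 d]. *)
pose C : R := 72 * q%:R + 86 + 432 * (c * (6 * q%:R + 5)).
have cq : 0 <= c * (6 * q%:R + 5) by rewrite mulr_ge0 //; lra.
have C1 : 72 * q%:R <= C by rewrite /C; lra.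
have C2 : 86 <= C by rewrite /C; lra.
have C3 : 432 * (c * (6 * q%:R + 5)) <= C by rewrite /C; lra.
exists C; split; first by lra.
exists decoder => d m Y d2 m1 Ym.
pose L := (trunc_log 2 d).+2.
have L0 : (0 < L)%N by [].
have d0 : (0 < d)%N by rewrite ltnW.
have dL : (2 * d < 2 ^ L)%N by rewrite expnS ltn_pmul2l // trunc_log_ltn.
have dL' : (d <= 2 ^ L)%N by rewrite (leq_trans _ (ltnW dL)) // leq_pmull.
(* Differences of points of [Y] are [2 m]-sparse, but residuals of the decoder can reach [3 m]. *)
have [adj expP] : exists adj : 'I_(L * (3 * m * q)) -> 'I_d -> bool, expander adj L (3 * m).
  apply: expander_of_size dL; last by rewrite qE.
  by rewrite !muln_gt0 m1 qE expn_gt0.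
have LR : L%:R <= 6 * ln d%:R :> R := trunc_log_le_ln R d2.
have L1 : 1 <= L%:R :> R by rewrite ler1n.
have lnd := @ln_ge_half R d d2.
have mR : 1 <= m%:R :> R by rewrite ler1n.
set ld := ln d%:R in LR lnd *.
exists _, (sketch_mx R adj); split.
- rewrite -muln2 !natrM.
  have h : L%:R <= 12 * ld ^+ 2 by rewrite expr2; nra.
  have mq : 0 <= 6 * (m%:R * q%:R) :> R by rewrite mulr_ge0 // mulr_ge0 // ltW //; lra.
  have h1 := ler_wpM2l mq h.
  have h2 : 72 * q%:R * (m%:R * ld ^+ 2) <= C * (m%:R * ld ^+ 2).
    by rewrite ler_wpM2r // mulr_ge0 ?sqr_ge0 //; lra.
  by move: h1 h2; set a := ld ^+ 2; set b := m%:R; set e := q%:R; set l := L%:R; lra.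
- exists (3 / 4 * L%:R), (2 * L%:R); split.
  + by rewrite mulr_gt0 //; lra.
  + by rewrite mulr_gt0 //; lra.
  + move=> m2; have lnm := @ln_ge_half R m m2; set lm := ln m%:R in lnm *.
    have -> : 2 * L%:R / (3 / 4 * L%:R) = 8 / 3 :> R by field; rewrite gt_eqF //; lra.
    have h1 : 1 / 4 <= ld ^+ 2 by rewrite expr2; nra.
    have h2 : 1 / 4 <= lm ^+ 2 by rewrite expr2; nra.
    have h3 : 1 / 8 <= lm ^+ 3 by rewrite exprS; nra.
    have h4 : 1 / 32 <= ld ^+ 2 * lm ^+ 3 by nra.
    by rewrite -mulrA; nra.
  + move=> x y Yx Yy; rewrite -mulmxBr; split.
      apply: (l1norm_sketch_ge expP); apply: leq_trans (nnzB _ _) _.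
      by have := Ym _ Yx; have := Ym _ Yy; lia.
    exact: (l1norm_sketch_le expP).
move=> x Yx.
have [t [s [ex tle out]]] := decoder_spec expP L0 d0 dL' (Ym _ Yx).
exists t, s; split=> // m2.
have lnm := @ln_ge_half R m m2; set lm := ln m%:R in lnm *.
(* Here [2 L + 1 <= 3 L], and [n + 4 m L + 1] with [n = 6 m q L] is at most [m L (6 q + 5)]. *)
have {}tle : (t <= csize decoder * (3 * L * (m * L * (6 * q + 5))))%N.
  apply: leq_trans tle _; rewrite leq_mul2l; apply/orP; right.
  apply: leq_mul; first by lia.
  have : (1 <= m * L)%N by rewrite muln_gt0 m1.
  by rewrite -muln2; nia.
have h1 : 1 <= 4 * lm ^+ 2 by rewrite expr2; nra.
have h2 : L%:R ^+ 2 <= 36 * ld ^+ 2 by rewrite !expr2; nra.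
have h3 : L%:R ^+ 2 <= 144 * (lm ^+ 2 * ld ^+ 2).
  have := sqr_ge0 ld; nra.
have h4 : 3 * (c * (6 * q%:R + 5)) * m%:R * L%:R ^+ 2 <=
    3 * (c * (6 * q%:R + 5)) * m%:R * (144 * (lm ^+ 2 * ld ^+ 2)).
  by rewrite ler_wpM2l // mulr_ge0 ?mulr_ge0 //; lra.
have h5 : 432 * (c * (6 * q%:R + 5)) * (m%:R * (lm ^+ 2 * ld ^+ 2)) <=
    C * (m%:R * (lm ^+ 2 * ld ^+ 2)).
  by rewrite ler_wpM2r // mulr_ge0 // mulr_ge0 ?sqr_ge0.
have h6 : t%:R <= 3 * (c * (6 * q%:R + 5)) * m%:R * L%:R ^+ 2.
  apply: (@le_trans _ _ (csize decoder * (3 * L * (m * L * (6 * q + 5))))%N%:R).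
    by rewrite ler_nat.
  by rewrite !natrM natrD natrM -/c expr2; lra.
apply: le_trans h6 _; apply: le_trans h4 _.
move: h5; lra.
Qed.
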